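(* Let $t>0$ be the real number with $\tanh t=0.75$ and let $$ g= \begin{bmatrix} e^t & 0 & 0 \\ 0 & 1 & 0 \\ 0& 0 & e^{-t} \end{bmatrix} , \qquad h= \begin{bmatrix} \cosh t & 0 & \sinh t \\ 0 & 1 & 0 \\ \sinh t & 0 & \cosh t \end{bmatrix} $$ in $\mathrm{SL}(3,\mathbb R)$, and let $\Gamma_1$ be the subgroup of $\mathrm{SL}(3,\mathbb R)$ generated by $g$ and $h$. If $g',h'\in \mathrm{SL}(3,\mathbb R)$ satisfy $$\max\{ |g-g'|_{Fr},\ |h-h'|_{Fr}\}\le 10^{-15309},$$ then the subgroup $\Gamma_1'$ of $\mathrm{SL}(3,\mathbb R)$ generated by $g',h'$ is Anosov.
   Context: $|A|_{Fr}=\sqrt{\mathrm{trace}(A^TA)}$ is the Frobenius norm. Anosov: here Anosov is with respect to the minimal parabolic subgroup (Borel subgroup) of $\mathrm{SL}(3,\mathbb R)$. The characterization used is that of Kapovich--Leeb--Porti (Morse actions): a finitely generated subgroup $\Gamma\subset \mathrm{SL}(3,\mathbb R)$ is Anosov if it is word hyperbolic and, for a finite generating set, there are constants such that the orbit map $\gamma\mapsto \gamma p$ into the symmetric space $\mathbb X=\mathrm{SL}(3,\mathbb R)/\mathrm{SO}(3)$ sends every (discrete) geodesic of the Cayley graph to a uniform Morse quasigeodesic, i.e. a sequence $(x_n)$ for which there are uniform constants $c_1,c_2,c_3,c_4,D,\alpha_0>0$ with $\frac1{c_1}|N|-c_2\le d(x_n,x_{n+N})\le c_3|N|+c_4$ and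 such that for all $n\le m$ there is a diamond $\diamondsuit_{\alpha_0}(a,b)$ with $d(a,x_n),d(b,x_m)\le D$ and $d(x_i,\diamondsuit_{\alpha_0}(a,b))\le D$ for $n\le i\le m$. Here $\diamondsuit_{\alpha_0}(a,b)=V(a,\sigma_{ab},\alpha_0)\cap V(b,\sigma_{ba},\alpha_0)$, where $V(a,\sigma_{ab},\alpha_0)$ is the set of points on geodesic rays from $a$ with asymptotic direction in the ideal Weyl chamber $\sigma_{ab}$ determined by the regular segment $ab$ and on which all simple roots are at least $\alpha_0$ times the length. This is equivalent to the standard singular value gap definition: there are $C,c>0$ with $\log\frac{\sigma_i(\gamma)}{\sigma_{i+1}(\gamma)}\ge C\,|\gamma|-c$ for $i=1,2$ and all $\gamma\in\Gamma$, where $\sigma_1\ge\sigma_2\ge\sigma_3$ are the singular values and $|\gamma|$ is word length with respect to a finite generating set. *)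

(* Defs.v *)
From HB Require Import structures.
From mathcomp Require Import all_boot all_order all_algebra.
From mathcomp Require Import all_classical all_reals all_analysis.

Set Implicit Arguments.
Unset Strict Implicit.
Unset Printing Implicit Defensive.

Import Order.TTheory GRing.Theory Num.Theory.

Local Open Scope classical_set_scope.
Local Open Scope ring_scope.

Section Hyperbolic.
Variable R : realType.

Definition cosh (t : R) : R := (expR t + expR (- t)) / 2.
Definition sinh (t : R) : R := (expR t - expR (- t)) / 2.
Definition tanh (t : R) : R := sinh t / cosh t.

End Hyperbolic.

Section Matrices.
Variable R : realType.

Definition mx3 (rows : seq (seq R)) : 'M[R]_3 :=
  \matrix_(i < 3, j < 3) nth 0 (nth [::] rows i) j.

Definition frobenius (A : 'M[R]_3) : R := Num.sqrt (\tr (A^T *m A)).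

Definition SL3 : set 'M[R]_3 := [set A | \det A = 1].
Definition SO3 : set 'M[R]_3 := [set A | A^T *m A = 1%:M /\ \det A = 1].

Definition subgroup_SL3 (G : set 'M[R]_3) : Prop :=
  [/\ G `<=` SL3, G 1 & forall x y, G x -> G y -> G (x * y^-1)].

(* Meaningful for [S `<=` SL3]; otherwise no subgroup contains [S]. *)
Definition generated (S : set 'M[R]_3) : set 'M[R]_3 := smallest subgroup_SL3 S.

End Matrices.

Section WordMetric.
Variable R : realType.
Implicit Types (G S : set 'M[R]_3) (x y : 'M[R]_3).

Definition finite_generating_set G S : Prop := finite_set S /\ generated S = G.

(* [x] is a product of [n] letters taken in the union of [S] and its inverses. *)
Definition spelled S x (n : nat) : Prop :=
  exists w : seq 'M[R]_3,
    [/\ forall s, s \in w -> S s \/ S s^-1, x = \prod_(s <- w) s & size w = n].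

(* The default value 0 is only reached outside the subgroup generated by [S]. *)
Definition word_length S x : nat :=
  xget 0%N [set n | spelled S x n /\ forall m, spelled S x m -> (n <= m)%N].

Definition word_dist S x y : nat := word_length S (x^-1 * y).

(* Gromov's four-point condition. *)
Definition word_hyperbolic G : Prop :=
  exists2 S, finite_generating_set G S &
  exists delta : nat, forall x y z w, G x -> G y -> G z -> G w ->
    (word_dist S x y + word_dist S z w <=
     maxn (word_dist S x z + word_dist S y w)
          (word_dist S x w + word_dist S y z) + delta)%N.

(* Geodesic segments, rays and lines are all covered, [I] being an arbitrary
   interval of integers. *)
Definition cayley_geodesic G S (I : interval int) (gam : int -> 'M[R]_3) : Prop :=
  (forall n, n \in I -> G (gam n)) /\
  (forall n m, n \in I -> m \in I -> word_dist S (gam n) (gam m) = `|m - n|%N).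

End WordMetric.

Section SymmetricSpace.
Variable R : realType.
Implicit Types (g : 'M[R]_3) (H : 'rV[R]_3).

(* Points of SL(3,R)/SO(3) are left cosets, regarded as sets of matrices. *)
Definition coset g : set 'M[R]_3 := [set g *m k | k in @SO3 R].

Definition symspace : set (set 'M[R]_3) := [set coset g | g in @SL3 R].

Definition act g (x : set 'M[R]_3) : set 'M[R]_3 := [set g *m b | b in x].

(* The Cartan subalgebra of traceless diagonal matrices, each given by its row
   of diagonal entries; [H 0 i - H 0 j] with j = i + 1 are the simple roots. *)
Definition cartan : set 'rV[R]_3 := [set H | \sum_i H 0 i = 0].

Definition cartan_norm H : R := Num.sqrt (\sum_i H 0 i ^+ 2).

Definition cartan_exp H : 'M[R]_3 := diag_mx (\row_i expR (H 0 i)).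

Definition simple_roots_ge (c : R) H : Prop :=
  forall i j : 'I_3, j = i.+1 :> nat -> c <= H 0 i - H 0 j.

Definition dominant H : Prop := simple_roots_ge 0 H.

Definition regular_dominant H : Prop :=
  forall i j : 'I_3, j = i.+1 :> nat -> 0 < H 0 i - H 0 j.

(* The maps H |-> coset (g *m cartan_exp H) with g in SL(3,R) parametrize the
   maximal flats isometrically. Any two points x, y of the symmetric space lie
   in a common maximal flat, so x = coset g and y = coset (g *m cartan_exp H)
   for some g and H; by the Cartan decomposition H is unique up to permutation
   of its entries. Hence the set below is a singleton when x and y are points
   of the symmetric space, and its element is their Riemannian distance. *)
Definition dist (x y : set 'M[R]_3) : R :=
  inf [set r | exists g H, [/\ SL3 g, cartan H, x = coset g,
                               y = coset (g *m cartan_exp H) &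
                               r = cartan_norm H]].

Definition std_ray g H : R -> set 'M[R]_3 :=
  fun t => coset (g *m cartan_exp (t *: H)).

Definition unit_direction H : Prop := cartan H /\ cartan_norm H = 1.

(* Only the values at nonnegative times are relevant. *)
Definition geodesic_ray (r : R -> set 'M[R]_3) : Prop :=
  exists g H, [/\ SL3 g, unit_direction H & forall t, 0 <= t -> r t = std_ray g H t].

Definition asymptotic (r r' : R -> set 'M[R]_3) : Prop :=
  exists B : R, forall t, 0 <= t -> dist (r t) (r' t) <= B.

(* An ideal Weyl chamber is encoded by the set of all geodesic rays whose
   asymptotic class belongs to it. *)
Definition ideal_chamber g : set (R -> set 'M[R]_3) :=
  [set r | geodesic_ray r /\
           exists H, [/\ unit_direction H, dominant H & asymptotic r (std_ray g H)]].

(* The ideal Weyl chamber determined by the segment from [a] to [b] if that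
   segment is regular, and the empty set otherwise. When the segment is regular
   [g] is unique up to right multiplication by diagonal sign matrices, which
   does not change [ideal_chamber g]. *)
Definition segment_chamber (a b : set 'M[R]_3) : set (R -> set 'M[R]_3) :=
  [set r | exists g H, [/\ SL3 g, cartan H /\ regular_dominant H, a = coset g,
                           b = coset (g *m cartan_exp H) & ideal_chamber g r]].

(* Rays have unit speed, so on such a ray the simple roots are at least [alpha0]
   times the length. *)
Definition uniformly_regular_ray (alpha0 : R) (r : R -> set 'M[R]_3) : Prop :=
  exists g H, [/\ SL3 g, unit_direction H, dominant H, simple_roots_ge alpha0 H &
                  forall t, 0 <= t -> r t = std_ray g H t].

Definition weyl_cone (a : set 'M[R]_3) (sigma : set (R -> set 'M[R]_3))
    (alpha0 : R) : set (set 'M[R]_3) :=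
  [set z | exists r t, [/\ sigma r, r 0 = a, uniformly_regular_ray alpha0 r,
                           0 <= t & z = r t]].

Definition diamond (alpha0 : R) (a b : set 'M[R]_3) : set (set 'M[R]_3) :=
  weyl_cone a (segment_chamber a b) alpha0 `&`
  weyl_cone b (segment_chamber b a) alpha0.

Definition morse_quasigeodesic (c1 c2 c3 c4 D alpha0 : R) (I : interval int)
    (x : int -> set 'M[R]_3) : Prop :=
  [/\ forall n, n \in I -> symspace (x n),
      forall n N : int, n \in I -> n + N \in I ->
        c1^-1 * `|N|%:~R - c2 <= dist (x n) (x (n + N)) <= c3 * `|N|%:~R + c4 &
      forall n m : int, n \in I -> m \in I -> n <= m ->
        exists a b, [/\ symspace a, symspace b, dist a (x n) <= D,
                        dist b (x m) <= D &
          forall i : int, n <= i <= m ->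
            exists2 z, diamond alpha0 a b z & dist (x i) z <= D]].

End SymmetricSpace.

Definition anosov (R : realType) (G : set 'M[R]_3) : Prop :=
  [/\ subgroup_SL3 G, word_hyperbolic G &
      exists2 S, finite_generating_set G S &
      forall p, symspace p ->
      exists c1 c2 c3 c4 D alpha0 : R,
        [/\ 0 < c1, 0 < c2 & 0 < c3] /\ [/\ 0 < c4, 0 < D & 0 < alpha0] /\
        forall (I : interval int) (gam : int -> 'M[R]_3),
          cayley_geodesic G S I gam ->
          morse_quasigeodesic c1 c2 c3 c4 D alpha0 I (fun n => act (gam n) p)].

(* Main.v *)
(** Since [expR t ^+ 2 = 7], the generators preserve the plane spanned by the
first and third basis vectors and fix the second one; on the plane they form a
Schottky pair whose four attracting intervals, centred at the angles 0, 90, 45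
and -45 degrees, have half-opening atan(1/sqrt 7), less than 22.5 degrees. Four
slightly larger disjoint cones in R^3, thin in the second direction, are
therefore mapped strictly inside each other by each letter, uniformly expanding
lengths, and this persists for the perturbed generators and for their
transposes. Along a reduced word, propagating vectors of these cones from both
ends gives an expanded and a contracted direction, and the cross product of two
propagated covectors gives a direction that stays close to the second basis
vector. In the resulting frame the logarithms of the lengths gain a definite
amount on both simple roots at every step, so that the orbit stays at bounded
distance from a uniformly regular path in a flat: this provides the diamonds.
Expansion also shows that nonempty reduced words act nontrivially, so that the
group is free and its Cayley graph is a tree. *)

Require Import Defs.
From mathcomp Require Import all_boot all_order all_algebra.
From mathcomp Require Import all_classical all_reals all_analysis.
From mathcomp Require Import ring lra zify.

Import Order.TTheory GRing.Theory Num.Theory.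

Local Open Scope classical_set_scope.
Local Open Scope ring_scope.

(** * Matrices of size 3 *)

(** All metric estimates pass through the squared Frobenius norm of [invmx A *m B]: it is
    submultiplicative, and its logarithm controls [dist] from both sides up to constants. The middle
    direction cannot be transported like the other two, since an approximate vector drifts towards
    the expanded direction whichever end it is propagated from. A plane, encoded by a covector, is
    stable when propagated from the right end, and two planes coming from opposite ends meet in the
    middle direction; hence the cross product. A frame becomes a point of a flat when its columns
    are rescaled to a common size: the logarithms of the scaling factors are the Cartan coordinates,
    so growth of columns turns into growth of simple roots. *)

Lemma ord3P (P : 'I_3 -> Prop) : P 0 -> P 1 -> P 2 -> forall i, P i.
Proof.
by move=> P0 P1 P2 [[|[|[|//]]] lti];
  [move: P0|move: P1|move: P2]; congr P; apply: val_inj.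
Qed.

Lemma sum3 (V : nmodType) (F : 'I_3 -> V) : \sum_i F i = F 0 + F 1 + F 2.
Proof.
rewrite !big_ord_recl big_ord0 addr0 addrA.
by congr (_ + F _ + F _); apply: val_inj.
Qed.

Lemma mulmx3E (R : pzRingType) m n (A : 'M[R]_(m, 3)) (B : 'M[R]_(3, n)) i j :
  (A *m B) i j = A i 0 * B 0 j + A i 1 * B 1 j + A i 2 * B 2 j.
Proof. by rewrite mxE sum3. Qed.

Lemma mx3E (R : realType) (a b c d e f g h k : R)
    (A := mx3 [:: [:: a; b; c]; [:: d; e; f]; [:: g; h; k]]) :
  ((A 0 0 = a) * (A 0 1 = b) * (A 0 2 = c) *
   (A 1 0 = d) * (A 1 1 = e) * (A 1 2 = f) *
   (A 2 0 = g) * (A 2 1 = h) * (A 2 2 = k))%type.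
Proof. by do !split; rewrite mxE. Qed.

Lemma matrix3P (R : Type) (A B : 'M[R]_3) :
  A 0 0 = B 0 0 -> A 0 1 = B 0 1 -> A 0 2 = B 0 2 ->
  A 1 0 = B 1 0 -> A 1 1 = B 1 1 -> A 1 2 = B 1 2 ->
  A 2 0 = B 2 0 -> A 2 1 = B 2 1 -> A 2 2 = B 2 2 -> A = B.
Proof.
move=> *; apply/matrixP => i j; move: i j.
by apply: ord3P; apply: ord3P.
Qed.

Lemma id3E (R : pzRingType) (I := 1%:M : 'M[R]_3) :
  ((I 0 0 = 1) * (I 0 1 = 0) * (I 0 2 = 0) *
   (I 1 0 = 0) * (I 1 1 = 1) * (I 1 2 = 0) *
   (I 2 0 = 0) * (I 2 1 = 0) * (I 2 2 = 1))%type.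
Proof. by do !split; rewrite mxE. Qed.

Lemma det3 (R : comPzRingType) (A : 'M[R]_3) : \det A =
  A 0 0 * (A 1 1 * A 2 2 - A 1 2 * A 2 1)
  - A 0 1 * (A 1 0 * A 2 2 - A 1 2 * A 2 0)
  + A 0 2 * (A 1 0 * A 2 1 - A 1 1 * A 2 0).
Proof.
pose a i j := A (inord i) (inord j).
have E i j : A i j = a i j by rewrite /a !inord_val.
rewrite (expand_det_row _ 0) sum3 /cofactor.
rewrite !(expand_det_row _ (0 : 'I_2)) !big_ord_recl !big_ord0 /cofactor.
rewrite !det_mx11 !mxE !E /= -[((1 %% 3 + 1 %% 3) %% 3)%N]/2%N.
rewrite -[(1 %% 3)%N]/1%N /bump /=.
rewrite !expr0 !expr1 !addr0 ?sqrr_sign ?expr2 ?mulrNN; ring.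
Qed.

(** * Diagonalization of symmetric matrices of positive determinant *)

Section Spectral.
Variable R : realType.
Implicit Types (A B M P Q : 'M[R]_3).

Lemma orthogonal_completion (v : 'cV[R]_3) :
    v 0 0 ^+ 2 + v 1 0 ^+ 2 + v 2 0 ^+ 2 = 1 ->
  exists Q, Q^T *m Q = 1%:M /\ [/\ Q 0 0 = v 0 0, Q 1 0 = v 1 0 & Q 2 0 = v 2 0].
Proof.
move: (v 0 0) (v 1 0) (v 2 0) => x y z n1.
have [s0|s_neq0] := eqVneq (x ^+ 2 + y ^+ 2) 0.
  have /andP[/eqP x0 /eqP y0] : (x == 0) && (y == 0).
    by rewrite -(sqrf_eq0 x) -(sqrf_eq0 y) -paddr_eq0 ?sqr_ge0// s0.
  have z1 : z ^+ 2 = 1 by rewrite x0 y0 in n1; lra.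
  exists (mx3 [:: [:: 0; 1; 0]; [:: 0; 0; 1]; [:: z; 0; 0]]).
  split; last by rewrite !mx3E x0 y0.
  apply: matrix3P; rewrite mulmx3E !id3E ![_^T _ _]mxE !mx3E; try lra.
set s := Num.sqrt (x ^+ 2 + y ^+ 2).
have s2 : s ^+ 2 = x ^+ 2 + y ^+ 2 by rewrite sqr_sqrtr// addr_ge0 ?sqr_ge0.
have s0 : s != 0 by rewrite -sqrf_eq0 s2.
have zE : z ^+ 2 = 1 - s ^+ 2 by lra.
(* The second column is the horizontal unit vector orthogonal to [v], and the third is the cross
   product of the first two. *)
exists (mx3 [:: [:: x; - y / s; - z * x / s]; [:: y; x / s; - z * y / s];
                [:: z; 0; s]]).
split; last by rewrite !mx3E.
have E1 : x ^+ 2 / s ^+ 2 + y ^+ 2 / s ^+ 2 = 1 by rewrite -mulrDl -s2 divff ?sqrf_eq0.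
have E2 : s * s^-1 = 1 by rewrite divff.
apply: matrix3P; rewrite mulmx3E !id3E ![_^T _ _]mxE !mx3E; try lra.
- transitivity (- z / s * (x ^+ 2 + y ^+ 2) + z * s); first by field.
  by rewrite -s2; field.
- transitivity (- z / s * (x ^+ 2 + y ^+ 2) + z * s); first by field.
  by rewrite -s2; field.
- transitivity (z ^+ 2 * (x ^+ 2 / s ^+ 2 + y ^+ 2 / s ^+ 2) + s ^+ 2).
    by field.
  by rewrite E1 zE; ring.
Qed.

(** The second expression is the off-diagonal entry of the symmetric matrix with rows (a, b) and (b,
    c) after rotation by the angle with cosine [x] and sine [y]. The tangent [t] of that angle
    solves a quadratic equation. *)
Lemma jacobi_rotation (a b c : R) : exists x y : R,
  x ^+ 2 + y ^+ 2 = 1 /\ b * (x ^+ 2 - y ^+ 2) + (c - a) * x * y = 0.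
Proof.
have [->|b0] := eqVneq b 0.
  by exists 1, 0; split; ring.
set r := Num.sqrt ((c - a) ^+ 2 + 4 * b ^+ 2).
have r2 : r ^+ 2 = (c - a) ^+ 2 + 4 * b ^+ 2.
  by rewrite sqr_sqrtr// addr_ge0 ?sqr_ge0// mulr_ge0 ?sqr_ge0.
pose t := ((c - a) + r) / (2 * b).
have tE : b * (1 - t ^+ 2) + (c - a) * t = 0.
  transitivity ((4 * b ^+ 2 + (c - a) ^+ 2 - r ^+ 2) / (4 * b)).
    by rewrite /t; field.
  by rewrite r2; field.
set n := Num.sqrt (1 + t ^+ 2).
have n2 : n ^+ 2 = 1 + t ^+ 2 by rewrite sqr_sqrtr// addr_ge0 ?sqr_ge0.
have n0 : n != 0 by rewrite -sqrf_eq0 n2 gt_eqF// ltr_wpDr ?sqr_ge0.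
exists (n^-1), (t / n); split.
  transitivity ((1 + t ^+ 2) / n ^+ 2); first by field.
  by rewrite -n2 divff// sqrf_eq0.
transitivity ((b * (1 - t ^+ 2) + (c - a) * t) / n ^+ 2); first by field.
by rewrite tE mul0r.
Qed.

(** The characteristic polynomial is [- \det P] at 0 and positive far to the right, so it has a real
    root. Symmetry turns the row eigenvector into a column. *)
Lemma eigenvector3 P : 0 < \det P -> P^T = P ->
  exists (l : R) (v : 'cV[R]_3),
    v 0 0 ^+ 2 + v 1 0 ^+ 2 + v 2 0 ^+ 2 = 1 /\ P *m v = l *: v.
Proof.
move=> detP symP.
have [b bP] := monic_Cauchy_bound (char_poly_monic P).
have p0 : (char_poly P).[0] < 0.
  by rewrite horner_coef0 char_poly_det -signr_odd /= expr1 mulN1r oppr_lt0.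
pose c := Num.max b 0.
have pc : 0 < (char_poly P).[c] by apply: bP; rewrite le_max lexx.
have c0 : 0 <= c by rewrite le_max lexx orbT.
have /(poly_ivt c0)[l _] : (char_poly P).[0] <= 0 <= (char_poly P).[c].
  by rewrite !ltW.
rewrite -eigenvalue_root_char => /eigenvalueP[u uP u0].
set n := u 0 0 ^+ 2 + u 0 1 ^+ 2 + u 0 2 ^+ 2.
have n_ge0 : 0 <= n by rewrite !addr_ge0 ?sqr_ge0.
have n0 : n != 0.
  apply: contraNneq u0 => /eqP; rewrite !paddr_eq0 ?addr_ge0 ?sqr_ge0// !sqrf_eq0.
  move=> /andP[/andP[/eqP u00 /eqP u01] /eqP u02]; apply/eqP/rowP; apply: ord3P;
  by rewrite ?u00 ?u01 ?u02 mxE.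
exists l, ((Num.sqrt n)^-1 *: u^T); split.
  rewrite !mxE !exprMn -!mulrDr exprVn sqr_sqrtr// -/n mulVf//.
by rewrite -scalemxAr -{1}symP -trmx_mul uP linearZ /= scalerA mulrC -scalerA.
Qed.

(** Deflation: in an orthonormal basis starting with an eigenvector, symmetry splits off a block of
    size 2, which a Jacobi rotation diagonalizes. *)
Lemma spectral3 P : 0 < \det P -> P^T = P ->
  exists Q (d : 'rV[R]_3), Q^T *m Q = 1%:M /\ Q^T *m P *m Q = diag_mx d.
Proof.
move=> detP symP; have [l [v [v1 Pv]]] := eigenvector3 _ detP symP.
have [Q [QQ [Q0 Q1 Q2]]] := orthogonal_completion _ v1.
have Qv : Q *m delta_mx 0 0 = v.
  apply/colP; apply: ord3P; rewrite mulmx3E !mxE /= ?Q0 ?Q1 ?Q2; ring.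
have [B BE] : exists B, B = Q^T *m P *m Q by eexists.
have symB i j : B i j = B j i.
  have BT : B^T = B by rewrite BE !trmx_mul symP trmxK mulmxA.
  by rewrite -{1}BT mxE.
have B0 : B *m delta_mx 0 0 = l *: (delta_mx 0 0 : 'cV[R]_3).
  rewrite BE -!mulmxA Qv Pv -scalemxAr -Qv [Q^T *m _]mulmxA QQ mul1mx //.
have B10 : B 1 0 = 0.
  by move/colP/(_ 1): B0; rewrite mulmx3E !mxE /= !(mulr1, mulr0, addr0).
have B20 : B 2 0 = 0.
  by move/colP/(_ 2): B0; rewrite mulmx3E !mxE /= !(mulr1, mulr0, addr0).
have [x [y [xy1 xy]]] := jacobi_rotation (B 1 1) (B 1 2) (B 2 2).
pose S : 'M[R]_3 := mx3 [:: [:: 1; 0; 0]; [:: 0; x; - y]; [:: 0; y; x]].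
have [D DD] : exists D, D = S^T *m B *m S by eexists.
exists (Q *m S), (\row_i D i i); split.
  rewrite trmx_mul -mulmxA [Q^T *m _]mulmxA QQ mul1mx.
  apply: matrix3P; rewrite mulmx3E !id3E ![_^T _ _]mxE !mx3E; try ring; lra.
have -> : (Q *m S)^T *m P *m (Q *m S) = D.
  by rewrite trmx_mul DD BE !mulmxA.
have [B01 B02 B21] : [/\ B 0 1 = 0, B 0 2 = 0 & B 2 1 = B 1 2].
  by rewrite (symB 0 1) (symB 0 2) (symB 2 1).
have DE i j : D i j = (S 0 i * B 0 0) * S 0 j
  + (S 1 i * B 1 1 + S 2 i * B 1 2) * S 1 j + (S 1 i * B 1 2 + S 2 i * B 2 2) * S 2 j.
  rewrite DD !mulmx3E ![_^T _ _]mxE B01 B02 B21 B10 B20; ring.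
have off : D 1 2 = 0 /\ D 2 1 = 0.
  by split; rewrite DE !mx3E -[RHS]xy; ring.
apply: matrix3P; rewrite [RHS]mxE /= ?mulr1n ?mulr0n; try (by rewrite mxE);
  try (by case: off);
  by rewrite DE !mx3E; ring.
Qed.

End Spectral.

(** * Distances in the symmetric space *)

Section SymSpace.
Variable R : realType.
Implicit Types (A B M K : 'M[R]_3) (H : 'rV[R]_3).

(** Invariant under orthogonal factors on both sides, so [F2 (invmx A *m B)] depends only on the two
    cosets. *)
Definition F2 A : R := \tr (A^T *m A).

Lemma F2E A : F2 A = \sum_i \sum_j A i j ^+ 2.
Proof.
rewrite /F2 /mxtrace exchange_big /=; apply: eq_bigr => j _.
by rewrite mxE; apply: eq_bigr => i _; rewrite mxE.
Qed.

Lemma F2_ge0 A : 0 <= F2 A.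
Proof. by rewrite F2E; do 2 (apply: sumr_ge0 => ? _); rewrite sqr_ge0. Qed.

Lemma cauchy_schwarz3 (a b c x y z : R) :
  (a * x + b * y + c * z) ^+ 2 <=
  (a ^+ 2 + b ^+ 2 + c ^+ 2) * (x ^+ 2 + y ^+ 2 + z ^+ 2).
Proof.
rewrite -subr_ge0.
have -> : (a ^+ 2 + b ^+ 2 + c ^+ 2) * (x ^+ 2 + y ^+ 2 + z ^+ 2) -
  (a * x + b * y + c * z) ^+ 2 =
  (a * y - b * x) ^+ 2 + (a * z - c * x) ^+ 2 + (b * z - c * y) ^+ 2 by ring.
by rewrite !addr_ge0 ?sqr_ge0.
Qed.

Lemma F2M A B : F2 (A *m B) <= F2 A * F2 B.
Proof.
rewrite !F2E [X in _ * X]exchange_big /= big_distrlr /=.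
apply: ler_sum => i _; apply: ler_sum => j _.
by rewrite mulmx3E !sum3 cauchy_schwarz3.
Qed.

Lemma F2_orthl K A : K^T *m K = 1%:M -> F2 (K *m A) = F2 A.
Proof. by move=> KK; rewrite /F2 trmx_mul -mulmxA [K^T *m _]mulmxA KK mul1mx. Qed.

Lemma F2_tr A : F2 A^T = F2 A.
Proof. by rewrite /F2 trmxK mxtrace_mulC. Qed.

Lemma F2_orthr K A : K^T *m K = 1%:M -> F2 (A *m K) = F2 A.
Proof.
move=> KK; rewrite -F2_tr trmx_mul F2_orthl ?F2_tr// trmxK.
exact: mulmx1C.
Qed.

Lemma F2_cartan_exp H : F2 (cartan_exp H) = \sum_i expR (H 0 i) ^+ 2.
Proof.
rewrite F2E !sum3 /cartan_exp !mxE /= ?mulr1n ?mulr0n; ring.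
Qed.

Lemma cartan_expD H H' : cartan_exp (H + H') = cartan_exp H *m cartan_exp H'.
Proof.
rewrite /cartan_exp mulmx_diag; congr diag_mx; apply/rowP => i.
by rewrite !mxE expRD.
Qed.

Lemma cartan_exp0 : cartan_exp (0 : 'rV[R]_3) = 1%:M.
Proof.
rewrite /cartan_exp -diag_const_mx; congr diag_mx; apply/rowP => i.
by rewrite !mxE expR0.
Qed.

Lemma cartan_expNK H : cartan_exp H *m cartan_exp (- H) = 1%:M.
Proof. by rewrite -cartan_expD subrr cartan_exp0. Qed.

Lemma det_cartan_exp H : cartan H -> \det (cartan_exp H) = 1.
Proof.
rewrite /cartan /= => H0; rewrite det_diag.
rewrite (eq_bigr (fun i => expR (H 0 i))) => [|i _]; last by rewrite !mxE.
by rewrite -expR_sum H0 expR0.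
Qed.

Lemma cartanD H H' : cartan H -> cartan H' -> cartan (H + H').
Proof.
rewrite /cartan /= => H0 H'0; under eq_bigr do rewrite mxE.
by rewrite big_split /= H0 H'0 addr0.
Qed.

Lemma cartanZ (c : R) H : cartan H -> cartan (c *: H).
Proof.
rewrite /cartan /= => H0; under eq_bigr do rewrite mxE.
by rewrite -mulr_sumr H0 mulr0.
Qed.

Lemma cartanN H : cartan H -> cartan (- H).
Proof. by move=> /(cartanZ (-1)); rewrite scaleN1r. Qed.

Lemma SL3_unit A : SL3 A -> A \in unitmx.
Proof. by rewrite /SL3 /= unitmxE => ->; rewrite unitr1. Qed.

Lemma SL3M A B : SL3 A -> SL3 B -> SL3 (A *m B).
Proof. by rewrite /SL3 /= det_mulmx => -> ->; rewrite mulr1. Qed.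

Lemma SL3V A : SL3 A -> SL3 (invmx A).
Proof. by rewrite /SL3 /= det_inv => ->; rewrite invr1. Qed.

Lemma SL3_1 : SL3 (1%:M : 'M[R]_3).
Proof. exact: det1. Qed.

Lemma SO3_SL3 A : SO3 A -> SL3 A. Proof. by case. Qed.

Lemma SO3_1 : SO3 (1%:M : 'M[R]_3).
Proof. by split; rewrite ?trmx1 ?mulmx1 ?det1. Qed.

Lemma SO3M A B : SO3 A -> SO3 B -> SO3 (A *m B).
Proof.
move=> [AA detA] [BB detB]; split; last by rewrite det_mulmx detA detB mulr1.
by rewrite trmx_mul -mulmxA [A^T *m _]mulmxA AA mul1mx.
Qed.

Lemma SO3T A : SO3 A -> SO3 A^T.
Proof. by move=> [AA detA]; split; rewrite ?det_tr// trmxK mulmx1C. Qed.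

Lemma cosetM A K : SO3 K -> coset (A *m K) = coset A.
Proof.
move=> K1; apply/seteqP; split => _ [k k1 <-].
  by exists (K *m k); rewrite ?mulmxA//; apply: SO3M.
exists (K^T *m k); first by apply: SO3M => //; apply: SO3T.
case: K1 => /mulmx1C KK _.
by rewrite mulmxA -[A *m K *m _]mulmxA KK mulmx1.
Qed.

Lemma coset_inj A B : coset A = coset B -> exists2 K, SO3 K & B = A *m K.
Proof.
move=> AB; have : coset B B by exists 1%:M; [exact: SO3_1|rewrite mulmx1].
by rewrite -AB => -[k k1 <-]; exists k.
Qed.

Lemma actE A B : act A (coset B) = coset (A *m B).
Proof.
apply/seteqP; split => [_ [_ [k k1 <-] <-]|_ [k k1 <-]].
  by exists k; rewrite ?mulmxA.
by exists (B *m k); [exists k|rewrite mulmxA].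
Qed.

Lemma cartan_norm_ge0 H : 0 <= cartan_norm H.
Proof. exact: sqrtr_ge0. Qed.

Lemma cartan_norm2 H : cartan_norm H ^+ 2 = \sum_i H 0 i ^+ 2.
Proof. by rewrite sqr_sqrtr// sumr_ge0// => i _; rewrite sqr_ge0. Qed.

Lemma cartan_norm_coord H i : H 0 i <= cartan_norm H.
Proof.
rewrite (le_trans (ler_norm _))// -sqrtr_sqr ler_wsqrtr//.
by rewrite (bigD1 i)//= lerDl sumr_ge0// => j _; rewrite sqr_ge0.
Qed.

Lemma cartan_norm_le H (c : R) : 0 <= c -> (forall i, `|H 0 i| <= c) ->
  cartan_norm H <= 2 * c.
Proof.
move=> c0 Hc; rewrite -[leRHS]ger0_norm ?mulr_ge0// -sqrtr_sqr ler_wsqrtr//.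
have sq i : H 0 i ^+ 2 <= c ^+ 2.
  by rewrite -real_normK ?num_real// lerXn2r ?nnegrE.
rewrite sum3; have := (sq 0, sq 1, sq 2) => -[[]] s0 s1 s2.
have := sqr_ge0 c; lra.
Qed.

(** The relative position [invmx A *m B] equals [cartan_exp H] up to orthogonal factors on the two
    sides. *)
Lemma dist_witness A B g H : SL3 A -> SL3 B -> coset A = coset g ->
  coset B = coset (g *m cartan_exp H) ->
  F2 (invmx A *m B) = \sum_i expR (H 0 i) ^+ 2.
Proof.
move=> A1 B1 /coset_inj[k [k1 k2] ->] /esym/coset_inj[k' [k1' k2'] ->].
rewrite -F2_cartan_exp -!mulmxA mulKmx ?SL3_unit// F2_orthl//.
by rewrite F2_orthr.
Qed.

(* No Cartan decomposition is needed here because [inf set0 = 0]. *)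
Lemma dist_le A B (c : R) : SL3 A -> SL3 B -> 1 <= c ->
  F2 (invmx A *m B) <= c -> dist (coset A) (coset B) <= 2 * ln c.
Proof.
move=> A1 B1 c1 Fc; rewrite /dist; set E := [set r | _].
have lnc : 0 <= ln c by rewrite ln_ge0.
have c0 : 0 < c by apply: lt_le_trans c1.
have [->|/set0P[r Er]] := eqVneq E set0; first by rewrite inf0 mulr_ge0.
have lbE : has_lbound E.
  by exists 0 => _ [g [H [_ _ _ _ ->]]]; exact: cartan_norm_ge0.
apply: le_trans (ge_inf lbE Er) _; case: Er => g [H [_ Hc AE BE ->]].
have := dist_witness _ _ _ _ A1 B1 AE BE; move=> FE; rewrite FE in Fc.
have Hi i : 2 * H 0 i <= ln c.
  rewrite -[leLHS]expRK ler_ln ?posrE ?expR_gt0//.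
  by rewrite (le_trans _ Fc)// expRM_natl (bigD1 i)//= lerDl sumr_ge0.
apply: cartan_norm_le => // i.
move: Hc; rewrite /cartan /= sum3 => Hc.
have := (Hi 0, Hi 1, Hi 2) => -[[]] H0 H1 H2.
by rewrite ler_norml; move: i; apply: ord3P; apply/andP; split; lra.
Qed.

(** Diagonalize [M *m M^T] by a rotation [K] and let [H] be half the logarithms of the eigenvalues;
    the remaining factor is then orthogonal. The eigenvalues are sums of squares with product 1,
    hence positive. *)
Lemma cartan_decomposition M : SL3 M ->
  exists K H K', [/\ SO3 K, cartan H, SO3 K' & M = K *m cartan_exp H *m K'].
Proof.
move=> M1; have [P PE] : exists P, P = M *m M^T by eexists.
have detP : \det P = 1 by rewrite PE det_mulmx det_tr M1 mulr1.
have symP : P^T = P by rewrite PE trmx_mul trmxK.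
have [|Q [d [QQ QPQ]]] := spectral3 _ P _ symP; first by rewrite detP.
have detQ2 : \det Q * \det Q = 1.
  by rewrite -{1}det_tr -det_mulmx QQ det1.
(* As the size is odd, scaling by the sign [\det Q] makes the determinant 1. *)
pose K := \det Q *: Q.
have K1 : SO3 K.
  split; rewrite /K.
    by rewrite [(_ *: _)^T]linearZ /= -scalemxAl -scalemxAr scalerA detQ2 scale1r.
  by rewrite detZ !exprS expr0 mulr1 detQ2 mulr1 detQ2.
have KPK : K^T *m P *m K = diag_mx d.
  by rewrite /K [(_ *: _)^T]linearZ /= -!scalemxAl -scalemxAr scalerA detQ2 scale1r.
have dE i : d 0 i = \sum_j (K^T *m M) i j ^+ 2.
  have -> : d 0 i = (diag_mx d) i i by rewrite mxE eqxx mulr1n.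
  have -> : diag_mx d = (K^T *m M) *m (K^T *m M)^T.
    by rewrite -KPK PE trmx_mul trmxK !mulmxA.
  by rewrite mxE; apply: eq_bigr => j _; rewrite [X in _ * X]mxE -expr2.
have dprod : \prod_i d 0 i = 1.
  by rewrite -det_diag -KPK !det_mulmx det_tr (SO3_SL3 _ K1) detP !mulr1.
have d_ge0 i : 0 <= d 0 i by rewrite dE sumr_ge0// => j _; rewrite sqr_ge0.
have d_gt0 i : 0 < d 0 i.
  rewrite lt_neqAle d_ge0 andbT eq_sym; apply/eqP => di0.
  by move: dprod; rewrite (bigD1 i)//= di0 mul0r => /esym/eqP; rewrite oner_eq0.
have [H HE] : exists H : 'rV[R]_3, forall i, H 0 i = ln (d 0 i) / 2.
  by exists (\row_i (ln (d 0 i) / 2)) => i; rewrite mxE.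
have expH i : expR (H 0 i) ^+ 2 = d 0 i.
  by rewrite HE -expRM_natl mulrC divfK// lnK// posrE.
have Hc : cartan H.
  rewrite /cartan /= -[LHS]expRK expR_sum.
  have : (\prod_i expR (H 0 i)) ^+ 2 = 1.
    by rewrite -prodrXl -[RHS]dprod; apply: eq_bigr => i _; rewrite expH.
  move=> /eqP; rewrite sqrf_eq1 => /orP[/eqP ->|/eqP E]; first by rewrite ln1.
  have : 0 <= \prod_i expR (H 0 i) by apply: prodr_ge0 => i _; rewrite expR_ge0.
  by rewrite E oppr_ge0 ler10.
exists K, H, (cartan_exp (- H) *m K^T *m M); split => //.
- split; last first.
    by rewrite !det_mulmx det_cartan_exp ?mul1r ?det_tr ?(SO3_SL3 _ K1) ?mul1r//; apply: cartanN.
  apply: mulmx1C.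
  rewrite !trmx_mul trmxK !mulmxA.
  rewrite -[_ *m M *m M^T]mulmxA -[_ *m K^T *m _]mulmxA -[_ *m (K^T *m _) *m _]mulmxA -PE KPK.
  rewrite /cartan_exp tr_diag_mx !mulmx_diag -diag_const_mx; congr diag_mx.
  apply/rowP => i; rewrite !mxE -expH !expRN.
  by field; rewrite gt_eqF ?expR_gt0.
case: K1 => /mulmx1C KK _.
by rewrite !mulmxA -[K *m _ *m _]mulmxA cartan_expNK mulmx1 KK mul1mx.
Qed.

(** A lower bound on the infimum also needs a witness, given by the Cartan decomposition. For every
    witness, three terms [expR (H 0 i) ^+ 2] add up to at least [c] and none exceeds
    [expR (2 * cartan_norm H)], whence [c / 3]. *)
Lemma dist_ge A B (c : R) : SL3 A -> SL3 B -> 0 < c ->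
  c <= F2 (invmx A *m B) -> ln (c / 3) / 2 <= dist (coset A) (coset B).
Proof.
move=> A1 B1 c0 cF; apply: lb_le_inf.
  have [K [H [K' [K1 Hc K1' AB]]]] :=
    cartan_decomposition _ (SL3M _ _ (SL3V _ A1) B1).
  exists (cartan_norm H), (A *m K), H; split => //.
  - by apply: SL3M => //; apply: SO3_SL3.
  - by rewrite cosetM.
  - by rewrite -[RHS](cosetM _ _ K1') -!mulmxA [K *m (_ *m _)]mulmxA -AB mulKVmx ?SL3_unit.
move=> _ [g [H [_ _ AE BE ->]]].
move: cF; rewrite (dist_witness _ _ _ _ A1 B1 AE BE) => cF.
rewrite ler_pdivrMr// -[leRHS]expRK ler_ln ?posrE ?expR_gt0 ?divr_gt0//.
rewrite ler_pdivrMr// (le_trans cF)// mulrC (_ : 3 = 1 + 1 + 1); last by ring.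
rewrite !mulrDl !mul1r sum3 mulrC expRM_natl.
by rewrite !lerD// lerXn2r ?nnegrE ?expR_ge0// ler_expR cartan_norm_coord.
Qed.

End SymSpace.

Arguments F2 {R} A.

(** * Cones *)

(* The first component selects the generator (true for g, false for h), the
   second one its exponent (true for 1, false for -1). *)
Definition letter : eqType := (bool * bool)%type.

Definition linv (l : letter) : letter := (l.1, ~~ l.2).

Lemma linvK : involutive linv.
Proof. by case=> b c; rewrite /linv /= negbK. Qed.

Lemma linv_neq l : l != linv l.
Proof. by case: l => [[] []]. Qed.

Section Cones.
Variable R : realType.
Implicit Types (l m : letter) (u v w : 'cV[R]_3) (e : R) (S : 'M[R]_3).

(* With [e = expR t] these are g, h and their inverses: since [e ^+ 2 = 7],
   [e^-1 = e / 7], [cosh t = 4 * e / 7] and [sinh t = 3 * e / 7]. *)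
Definition model e l : 'M[R]_3 :=
  match l with
  | (true, true) => mx3 [:: [:: e; 0; 0]; [:: 0; 1; 0]; [:: 0; 0; e / 7]]
  | (true, false) => mx3 [:: [:: e / 7; 0; 0]; [:: 0; 1; 0]; [:: 0; 0; e]]
  | (false, true) => mx3 [:: [:: 4 * e / 7; 0; 3 * e / 7]; [:: 0; 1; 0];
                             [:: 3 * e / 7; 0; 4 * e / 7]]
  | (false, false) => mx3 [:: [:: 4 * e / 7; 0; - (3 * e / 7)]; [:: 0; 1; 0];
                              [:: - (3 * e / 7); 0; 4 * e / 7]]
  end.

Definition near_model e l S := forall i j, `|S i j - model e l i j| <= 10 ^- 6.

(* Coordinate on the eigenvector of [model e l] for the eigenvalue [e], up to
   normalization; [along (linv l)] is the coordinate for [e^-1]. *)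
Definition along l u : R :=
  match l with
  | (true, true) => u 0 0
  | (true, false) => u 2 0
  | (false, true) => u 0 0 + u 2 0
  | (false, false) => u 0 0 - u 2 0
  end.

Definition r2 u : R := u 0 0 ^+ 2 + u 2 0 ^+ 2.

(* The slope 2/5 lies between 1/sqrt 7 (invariance) and tan(pi/8)
   (disjointness of the four cones). *)
Definition cone l u : Prop :=
  [/\ 0 < r2 u, 5 * `|along (linv l) u| <= 2 * `|along l u| &
      10 ^+ 6 * u 1 0 ^+ 2 <= r2 u].

(** The constant 25 is 10^6 / (4 * 10^4), from the bounds of [cross_small] and [cone_transverse]. *)
Definition mid_cone w : Prop := 0 < w 1 0 ^+ 2 /\ 25 * r2 w <= w 1 0 ^+ 2.

(** A cone of slope 2/5 about a diagonal contains only slopes between 3/7 = (1 - 2/5) / (1 + 2/5)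
    and its inverse. *)
Lemma slope_bound (x z : R) : 5 * `|x - z| <= 2 * `|x + z| ->
  3 * `|z| <= 7 * `|x| /\ 3 * `|x| <= 7 * `|z|.
Proof.
wlog : x z / 0 <= x + z => [IH|xz0].
  have [/IH//|xz_lt0] := lerP 0 (x + z).
  rewrite -(normrN x) -(normrN z) -[`|x + z|]normrN -[`|x - z|]normrN !opprD.
  by apply: IH; lra.
rewrite (ger0_norm xz0) => h.
have : `|x - z| <= 2 / 5 * (x + z) by lra.
rewrite ler_norml => /andP[h1 h2].
by rewrite !ger0_norm; try lra; split; lra.
Qed.

Lemma slope_bound_diag (x z : R) : 5 * `|z| <= 2 * `|x| ->
  3 * `|x - z| <= 7 * `|x + z| /\ 3 * `|x + z| <= 7 * `|x - z|.
Proof.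
move=> h; have [] := @slope_bound (x + z) (x - z) => //.
rewrite (_ : x + z - (x - z) = 2 * z); last by ring.
rewrite (_ : x + z + (x - z) = 2 * x); last by ring.
by rewrite !normrM normr_nat; lra.
Qed.

(** In the axes of [l], the cone of [m] is either that of [l] itself or one turned by 45 degrees,
    whose slopes are at most 7/3. Only the perpendicular cone of [linv l] is excluded. *)
Lemma cone_other l m u : cone m u -> m != linv l ->
  3 * `|along (linv l) u| <= 7 * `|along l u|.
Proof.
have sw (x z : R) : 5 * `|x + z| <= 2 * `|x - z| ->
    3 * `|z| <= 7 * `|x| /\ 3 * `|x| <= 7 * `|z|.
  by move=> h; rewrite -(normrN z); apply: slope_bound; rewrite opprK.
have sd (x z : R) : 5 * `|x| <= 2 * `|z| ->
    3 * `|x - z| <= 7 * `|x + z| /\ 3 * `|x + z| <= 7 * `|x - z|.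
  by move=> h; rewrite distrC [x + z]addrC; apply: slope_bound_diag.
have tr (p q : R) : 5 * `|p| <= 2 * `|q| -> 3 * `|p| <= 7 * `|q|.
  by have := normr_ge0 p; have := normr_ge0 q; lra.
by case=> _ + _ /eqP; case: l => [[] []]; case: m => [[] []] /= h;
  try (by move=> /(_ erefl)); move=> _;
  first [exact: tr | by case: (slope_bound _ _ h) | by case: (sw _ _ h)
        |by case: (slope_bound_diag _ _ h)|by case: (sd _ _ h)].
Qed.

Lemma model_tr e l : (model e l)^T = model e l.
Proof. by case: l => [[] []]; apply: matrix3P; rewrite mxE !mx3E. Qed.

Lemma near_tr e l S : near_model e l S -> near_model e l S^T.
Proof. by move=> Sl i j; rewrite -model_tr !mxE; apply: Sl. Qed.

Lemma center l : exists u, cone l u.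
Proof.
exists (\col_i nth 0 (match l with
  | (true, true) => [:: 1; 0; 0] | (true, false) => [:: 0; 0; 1]
  | (false, true) => [:: 1; 0; 1] | (false, false) => [:: 1; 0; -1] end) i).
by case: l => [[] []]; rewrite /cone /r2 /= !mxE /=; split;
   rewrite ?subrr ?addrN ?normr0 ?opprK ?ger0_norm//; try lra.
Qed.

Lemma r2Z (c : R) u : r2 (c *: u) = c ^+ 2 * r2 u.
Proof. by rewrite /r2 !mxE; ring. Qed.

Lemma alongZ (c : R) l u : along l (c *: u) = c * along l u.
Proof. by case: l => [[] []] /=; rewrite !mxE//; ring. Qed.

Lemma coneZ (c : R) l u : c != 0 -> cone l u -> cone l (c *: u).
Proof.
move=> c0 [u0 ul uy]; have c2 : 0 < c ^+ 2 by rewrite exprn_even_gt0.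
split.
- by rewrite r2Z mulr_gt0.
- rewrite !alongZ !normrM mulrCA [leRHS]mulrCA ler_pM2l// normr_gt0//.
- by rewrite r2Z mxE exprMn mulrCA ler_pM2l.
Qed.


(** [A] and [B] stand for the absolute coordinates along and across the axis, [A'] and [B'] for
    those of the image, and [d] for the perturbation; 2.64 and 2.65 enclose the square root of 7. *)
Lemma stretch_bounds (e A B A' B' d : R) : 0 <= A -> 0 <= B ->
    264 <= 100 * e -> 100 * e <= 265 -> 3 * B <= 7 * A ->
    10 ^+ 5 * d <= A + B -> e * A - d <= A' -> A' <= e * A + d ->
    7 * B' <= e * B + 7 * d ->
  [/\ 263 * A <= 100 * A', 100 * A' <= 266 * A & 100 * B' <= 38 * B + A].
Proof.
move=> A0 B0 e1 e2 ab hd h1 h2 h3.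
have k1 := ler_wpM2r A0 e1; have k2 := ler_wpM2r A0 e2.
have k3 := ler_wpM2r B0 e2.
by clear e1 e2 B0; split; lra.
Qed.

(** Source of the expansion factor: in the worst case [B] is 7/3 of [A], so the old squared length
    is 58/9 of [A ^+ 2], while the new one is at least 2.63^2 times [A ^+ 2]; the quotient exceeds
    1.07. The bound 8 leaves room above [e ^+ 2], which is 7. *)
Lemma stretch_squares (A B A' B' : R) : 0 <= A -> 0 <= B -> 0 <= A' -> 0 <= B' ->
    3 * B <= 7 * A -> 263 * A <= 100 * A' -> 100 * A' <= 266 * A ->
    100 * B' <= 38 * B + A ->
  [/\ 5 * B' <= 2 * A', 105 * (A ^+ 2 + B ^+ 2) <= 100 * (A' ^+ 2 + B' ^+ 2) &
      A' ^+ 2 + B' ^+ 2 <= 8 * (A ^+ 2 + B ^+ 2)].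
Proof.
have sq (x y : R) : 0 <= x -> x <= y -> x ^+ 2 <= y ^+ 2.
  by move=> x0 xy; rewrite lerXn2r ?nnegrE// (le_trans x0 xy).
move=> A0 B0 A'0 B'0 ab h1 h2 h3.
have k0 := sqr_ge0 A; have k0' := sqr_ge0 B; have k0'' := sqr_ge0 B'.
have k1 : (263 * A) ^+ 2 <= (100 * A') ^+ 2 by apply: sq; rewrite ?mulr_ge0 ?ler0n.
have k2 : (100 * A') ^+ 2 <= (266 * A) ^+ 2 by apply: sq; rewrite ?mulr_ge0 ?ler0n.
have k3 : (3 * B) ^+ 2 <= (7 * A) ^+ 2 by apply: sq; rewrite ?mulr_ge0 ?ler0n.
have k4 : (100 * B') ^+ 2 <= (38 * B + A) ^+ 2 by apply: sq; rewrite ?mulr_ge0 ?ler0n.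
split.
- by clear k0 k0' k0'' k1 k2 k3 k4; lra.
- by clear k2 k4 h1 h2 h3 ab A0 B0 A'0 B'0; lra.
- have k5 := sqr_ge0 (A - B).
  by clear k1 k3 h1 h2 h3 ab A0 B0 A'0 B'0; lra.
Qed.

Lemma stretch (e a b a' b' d : R) : 0 < e -> e ^+ 2 = 7 ->
    `|a' - e * a| <= d -> `|b' - e / 7 * b| <= d ->
    10 ^+ 5 * d <= `|a| + `|b| -> 3 * `|b| <= 7 * `|a| ->
  [/\ 5 * `|b'| <= 2 * `|a'|, 105 * (a ^+ 2 + b ^+ 2) <= 100 * (a' ^+ 2 + b' ^+ 2) &
      a' ^+ 2 + b' ^+ 2 <= 8 * (a ^+ 2 + b ^+ 2)].
Proof.
move=> e0 e2 ha hb hd ab.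
have e_lo : 264 <= 100 * e by nra.
have e_hi : 100 * e <= 265 by nra.
have e7 : 0 <= e / 7 by rewrite divr_ge0// ltW.
have na : `|e * a| = e * `|a| by rewrite normrM gtr0_norm.
have nb : `|e / 7 * b| = e / 7 * `|b| by rewrite normrM ger0_norm.
have a'_lo : e * `|a| - d <= `|a'|.
  rewrite lerBlDr -na -{1}(subrK a' (e * a)) addrC.
  by rewrite (le_trans (ler_normD _ _))// lerD2l distrC.
have a'_hi : `|a'| <= e * `|a| + d.
  rewrite -na -{1}(subrK (e * a) a') addrC.
  by rewrite (le_trans (ler_normD _ _))// lerD2l.
have b'_hi : 7 * `|b'| <= e * `|b| + 7 * d.
  suff : `|b'| <= e / 7 * `|b| + d by clear; lra.
  rewrite -nb -{1}(subrK (e / 7 * b) b') addrC.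
  by rewrite (le_trans (ler_normD _ _))// lerD2l.
have [] := stretch_bounds _ _ _ _ _ _ (normr_ge0 a) (normr_ge0 b) e_lo e_hi ab hd
  a'_lo a'_hi b'_hi.
have := stretch_squares `|a| `|b| `|a'| `|b'|.
by rewrite !real_normK ?num_real// => h *; apply: h.
Qed.

Lemma near_modelE e l S u i : near_model e l S ->
  `|(S *m u) i 0 - (model e l *m u) i 0| <=
  (`|u 0 0| + `|u 1 0| + `|u 2 0|) / 10 ^+ 6.
Proof.
move=> Sl; rewrite !mulmx3E.
have -> : S i 0 * u 0 0 + S i 1 * u 1 0 + S i 2 * u 2 0 -
  (model e l i 0 * u 0 0 + model e l i 1 * u 1 0 + model e l i 2 * u 2 0) =
  (S i 0 - model e l i 0) * u 0 0 + (S i 1 - model e l i 1) * u 1 0 +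
  (S i 2 - model e l i 2) * u 2 0 by ring.
have h k : `|(S i k - model e l i k) * u k 0| <= `|u k 0| / 10 ^+ 6.
  by rewrite normrM mulrC ler_wpM2l.
rewrite [leRHS]mulrDl [(_ + _) / 10 ^+ 6]mulrDl (le_trans (ler_normD _ _))// lerD//.
by rewrite (le_trans (ler_normD _ _))// lerD.
Qed.

Lemma model_along e l u : e ^+ 2 = 7 -> along l (model e l *m u) = e * along l u.
Proof.
by move=> e2; case: l => [[] []] /=; rewrite !mulmx3E !mx3E; field.
Qed.

Lemma model_across e l u :
  along (linv l) (model e l *m u) = e / 7 * along (linv l) u.
Proof. by case: l => [[] []] /=; rewrite !mulmx3E !mx3E; field. Qed.

Lemma model_mid e l u : (model e l *m u) 1 0 = u 1 0.
Proof. by case: l => [[] []] /=; rewrite !mulmx3E !mx3E; ring. Qed.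

Lemma r2_along l u : along l u ^+ 2 + along (linv l) u ^+ 2 =
  (if l.1 then 1 else 2) * r2 u.
Proof. by case: l => [[] []] /=; rewrite /r2; ring. Qed.

Lemma norm_along l u : `|u 0 0| + `|u 2 0| <= `|along l u| + `|along (linv l) u|.
Proof.
have h (x z : R) : `|x| + `|z| <= `|x + z| + `|x - z|.
  have := ler_normD (x + z) (x - z); have := ler_normB (x + z) (x - z).
  rewrite (_ : x + z - (x - z) = 2 * z); last by ring.
  rewrite (_ : x + z + (x - z) = 2 * x); last by ring.
  by rewrite !normrM normr_nat; lra.
by case: l => [[] []] /=; rewrite // [leRHS]addrC.
Qed.

Lemma along_sub l u v (d : R) : `|u 0 0 - v 0 0| <= d -> `|u 2 0 - v 2 0| <= d ->
  `|along l u - along l v| <= 2 * d.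
Proof.
move=> hx hz; have d0 := le_trans (normr_ge0 _) hx; move: hx hz.
by rewrite !ler_norml => /andP[? ?] /andP[? ?]; apply/andP;
  case: l => [[] []] /=; split; lra.
Qed.

(** The ping-pong step. Thinness makes the middle coordinate negligible in the planar estimate, and
    is itself preserved because the planar length grows faster than the middle coordinate can. *)
Lemma cone_step e l m S u : 0 < e -> e ^+ 2 = 7 -> near_model e l S ->
    cone m u -> m != linv l ->
  [/\ cone l (S *m u), 105 * r2 u <= 100 * r2 (S *m u) & r2 (S *m u) <= 8 * r2 u].
Proof.
move=> e0 e2 Sl um ml; have ab := cone_other l m u um ml.
case: um => u0 _ uy; set u' := S *m u.
have y_le : 100 * `|u 1 0| <= `|u 0 0| + `|u 2 0|.
  have x2 : u 0 0 ^+ 2 = `|u 0 0| ^+ 2 by rewrite real_normK ?num_real.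
  have z2 : u 2 0 ^+ 2 = `|u 2 0| ^+ 2 by rewrite real_normK ?num_real.
  have y2 : u 1 0 ^+ 2 = `|u 1 0| ^+ 2 by rewrite real_normK ?num_real.
  move: uy; rewrite /r2 x2 y2 z2.
  have := normr_ge0 (u 0 0); have := normr_ge0 (u 1 0); have := normr_ge0 (u 2 0).
  move: `|u 0 0| `|u 1 0| `|u 2 0| => X Y Z Z0 Y0 X0 YXZ.
  have sq (x y : R) : 0 <= x -> 0 <= y -> x ^+ 2 <= y ^+ 2 -> x <= y.
    by move=> x0 y0; rewrite ler_pXn2r ?nnegrE.
  apply: sq; [by rewrite mulr_ge0 ?ler0n|by rewrite addr_ge0|].
  by move: YXZ (mulr_ge0 X0 Z0) (sqr_ge0 Y); clear; lra.
set d := (`|u 0 0| + `|u 1 0| + `|u 2 0|) / 10 ^+ 6.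
have hE i : `|u' i 0 - (model e l *m u) i 0| <= d by apply: near_modelE.
have n_al := norm_along l u.
have [] := @stretch e (along l u) (along (linv l) u) (along l u')
    (along (linv l) u') (2 * d) => //.
- by rewrite -model_along//; apply: along_sub.
- by rewrite -model_across//; apply: along_sub.
- by move: n_al y_le (normr_ge0 (u 1 0)); clear; rewrite /d; lra.
move=> c1 c2 c3.
have {}c2 : 105 * r2 u <= 100 * r2 u'.
  by move: c2; rewrite !r2_along; clear; case: (l.1) => /=; lra.
have {}c3 : r2 u' <= 8 * r2 u.
  by move: c3; rewrite !r2_along; clear; case: (l.1) => /=; lra.
split => //; split => //; first by move: u0 c2; clear; lra.
have hy := hE 1; rewrite model_mid in hy.
have d2 : d ^+ 2 <= r2 u / 10 ^+ 11.
  have x2 : u 0 0 ^+ 2 = `|u 0 0| ^+ 2 by rewrite real_normK ?num_real.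
  have z2 : u 2 0 ^+ 2 = `|u 2 0| ^+ 2 by rewrite real_normK ?num_real.
  rewrite /d /r2 x2 z2.
  move: `|u 0 0| `|u 1 0| `|u 2 0| (normr_ge0 (u 0 0)) (normr_ge0 (u 1 0))
    (normr_ge0 (u 2 0)) y_le; clear => X Y Z X0 Y0 Z0 YXZ.
  have h : (X + Y + Z) ^+ 2 <= (2 * (X + Z)) ^+ 2.
    by rewrite lerXn2r ?nnegrE ?addr_ge0 ?mulr_ge0 ?addr_ge0//; lra.
  rewrite (_ : ((X + Y + Z) / 10 ^+ 6) ^+ 2 = (X + Y + Z) ^+ 2 / 10 / 10 ^+ 11).
    rewrite ler_pM2r ?invr_gt0 ?exprn_gt0//; move: h (sqr_ge0 (X - Z)) (sqr_ge0 X) (sqr_ge0 Z).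
    by clear; lra.
  by field.
have : (u' 1 0 - u 1 0) ^+ 2 <= d ^+ 2.
  by rewrite -[leLHS]real_normK ?num_real// lerXn2r ?nnegrE ?(le_trans _ hy).
(* Weighted mean inequality: [u' 1 0 ^+ 2] is at most 1.01 times [u 1 0 ^+ 2] plus 101 times
   [d ^+ 2], which stays below the gain 105/100 of [r2]. *)
have := sqr_ge0 (u 1 0 / 10 - 10 * (u' 1 0 - u 1 0)).
move: u0 uy c2 d2; clear; lra.
Qed.

End Cones.

Arguments model {R} e l.
Arguments near_model {R} e l S.
Arguments along {R} l u.
Arguments r2 {R} u.
Arguments cone {R} l u.
Arguments mid_cone {R} w.

(** * Transversality of the cones and the middle direction *)

Section Transversality.
Variable R : realType.
Implicit Types (l m : letter) (u v w : 'cV[R]_3) (e : R) (S : 'M[R]_3).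

(** The product of the slopes is at most 2/5 * 7/3 = 14/15 < 1, so the determinant retains at least
    1/15 of [a * d]; then 2 * 7 * 15^2 is below 10^4. *)
Lemma slopes_transverse (a b c d : R) :
    5 * `|b| <= 2 * `|a| -> 3 * `|c| <= 7 * `|d| ->
  (a ^+ 2 + b ^+ 2) * (c ^+ 2 + d ^+ 2) <= 10 ^+ 4 * (a * d - b * c) ^+ 2.
Proof.
move=> ba cd.
have sq (p q x y : R) : 0 <= p -> p * `|x| <= q * `|y| -> p ^+ 2 * x ^+ 2 <= q ^+ 2 * y ^+ 2.
  move=> p0 xy; rewrite -(real_normK (num_real x)) -(real_normK (num_real y)) -!exprMn.
  by rewrite lerXn2r ?nnegrE ?(le_trans _ xy) ?mulr_ge0.
have h1 := sq _ _ _ _ (ler0n _ 5) ba.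
have h2 := sq _ _ _ _ (ler0n _ 3) cd.
have h3 : `|a * d| <= 15 * `|a * d - b * c|.
  have k1 : `|a * d| <= `|a * d - b * c| + `|b * c|.
    by rewrite -{1}(subrK (b * c) (a * d)) ler_normD.
  have k2 : (5 * `|b|) * (3 * `|c|) <= (2 * `|a|) * (7 * `|d|).
    by apply: ler_pM => //; rewrite mulr_ge0 ?ler0n.
  by move: k1 k2; rewrite !normrM; clear; lra.
have h4 : 1 ^+ 2 * (a * d) ^+ 2 <= 15 ^+ 2 * (a * d - b * c) ^+ 2.
  by apply: sq; rewrite ?mul1r.
have h5 : (a ^+ 2 + b ^+ 2) * (c ^+ 2 + d ^+ 2) <= (2 * a ^+ 2) * (7 * d ^+ 2).
  apply: ler_pM; rewrite ?addr_ge0 ?sqr_ge0//.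
    by move: h1 (sqr_ge0 a); clear; lra.
  by move: h2 (sqr_ge0 d); clear; lra.
move: h4 h5 (sqr_ge0 (a * d - b * c)); rewrite exprMn.
move: ((a ^+ 2 + b ^+ 2) * _) ((a * d - b * c) ^+ 2); clear => p q; lra.
Qed.

Lemma cone_transverse l m u v : cone l u -> cone m v -> m != l ->
  r2 u * r2 v <= 10 ^+ 4 * (u 0 0 * v 2 0 - u 2 0 * v 0 0) ^+ 2.
Proof.
move=> [u0 ul _] vm ml.
have vl : 3 * `|along l v| <= 7 * `|along (linv l) v|.
  by have := cone_other _ (linv l) m v vm; rewrite linvK; apply.
have := slopes_transverse _ _ _ _ ul vl; rewrite !r2_along.
have -> : along l u * along (linv l) v - along (linv l) u * along l v =
    (if l.2 then 1 else -1) * (if l.1 then 1 else - 2) * (u 0 0 * v 2 0 - u 2 0 * v 0 0).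
  by case: l {ul vl ml} => [[] []] /=; ring.
move: (r2 u) (r2 v) (u 0 0 * _ - _); clear => p q x.
by case: (l.1); case: (l.2) => /=; lra.
Qed.

Definition cross u v : 'cV[R]_3 :=
  \col_i nth 0 [:: u 1 0 * v 2 0 - u 2 0 * v 1 0;
                   u 2 0 * v 0 0 - u 0 0 * v 2 0;
                   u 0 0 * v 1 0 - u 1 0 * v 0 0] i.

Lemma crossE u v :
  ((cross u v 0 0 = u 1 0 * v 2 0 - u 2 0 * v 1 0) *
   (cross u v 1 0 = u 2 0 * v 0 0 - u 0 0 * v 2 0) *
   (cross u v 2 0 = u 0 0 * v 1 0 - u 1 0 * v 0 0))%type.
Proof. by do !split; rewrite mxE. Qed.

(** Allows a vector to be followed through the two covectors that annihilate it. *)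
Lemma cross_adj S u v :
  S *m cross (S^T *m u) (S^T *m v) = \det S *: cross u v.
Proof.
apply/colP; apply: ord3P; rewrite mulmx3E !crossE !mulmx3E !mxE det3 /=;
  ring.
Qed.

(** Every product in the components 0 and 2 contains [u 1 0] or [v 1 0], which thinness bounds by a
    thousandth of the planar length. *)
Lemma cross_small l m u v : cone l u -> cone m v ->
  10 ^+ 6 * r2 (cross u v) <= 4 * (r2 u * r2 v).
Proof.
move=> [u0 _ uy] [v0 _ vy].
have h1 : (10 ^+ 6 * u 1 0 ^+ 2) * r2 v <= r2 u * r2 v by rewrite ler_pM2r.
have h2 : r2 u * (10 ^+ 6 * v 1 0 ^+ 2) <= r2 u * r2 v by rewrite ler_pM2l.
have h3 : r2 (cross u v) <= 2 * (u 1 0 ^+ 2 * r2 v) + 2 * (r2 u * v 1 0 ^+ 2).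
  rewrite /r2 !crossE -subr_ge0.
  have -> : 2 * (u 1 0 ^+ 2 * (v 0 0 ^+ 2 + v 2 0 ^+ 2)) +
    2 * ((u 0 0 ^+ 2 + u 2 0 ^+ 2) * v 1 0 ^+ 2) -
    ((u 1 0 * v 2 0 - u 2 0 * v 1 0) ^+ 2 + (u 0 0 * v 1 0 - u 1 0 * v 0 0) ^+ 2) =
    (u 1 0 * v 2 0 + u 2 0 * v 1 0) ^+ 2 + (u 0 0 * v 1 0 + u 1 0 * v 0 0) ^+ 2.
    by ring.
  by rewrite addr_ge0 ?sqr_ge0.
move: h1 h2 h3; move: (r2 u) (r2 v) (r2 _) (u 1 0) (v 1 0); clear => p q x y z.
by lra.
Qed.

Lemma cross_mid l m u v : cone l u -> cone m v -> m != l -> mid_cone (cross u v).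
Proof.
move=> ul vm ml; have h1 := cross_small _ _ _ _ ul vm.
have := cone_transverse _ _ _ _ ul vm ml; rewrite /mid_cone crossE.
case: ul vm => u0 _ _ [v0 _ _]; have := mulr_gt0 u0 v0.
move: (r2 u * r2 v) (r2 _) h1 (u 0 0 * v 2 0) (u 2 0 * v 0 0) => p q h1 x y p0.
by move: h1 p0; clear => *; split; lra.
Qed.

Lemma mid_step e l S w : near_model e l S -> mid_cone w ->
  99 * w 1 0 ^+ 2 <= 100 * (S *m w) 1 0 ^+ 2 /\
  100 * (S *m w) 1 0 ^+ 2 <= 101 * w 1 0 ^+ 2.
Proof.
move=> Sl [w0 wr]; have := near_modelE _ _ _ _ w 1 Sl; rewrite model_mid.
move: (S *m w) => w'.
have nl (x y : R) : 25 * x ^+ 2 <= y ^+ 2 -> 5 * `|x| <= `|y|.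
  move=> xy; rewrite -(@ler_pXn2r _ 2) ?nnegrE ?mulr_ge0 ?ler0n// exprMn !real_normK ?num_real//.
  by move: xy; clear; lra.
have hx : 5 * `|w 0 0| <= `|w 1 0|.
  by apply: nl; move: wr (sqr_ge0 (w 2 0)); rewrite /r2; clear; lra.
have hz : 5 * `|w 2 0| <= `|w 1 0|.
  by apply: nl; move: wr (sqr_ge0 (w 0 0)); rewrite /r2; clear; lra.
move=> hy; have {}hy : `|w' 1 0 - w 1 0| <= `|w 1 0| / 10 ^+ 3.
  by move: hx hz hy (normr_ge0 (w 1 0)); clear; lra.
have : (w' 1 0 - w 1 0) ^+ 2 <= (w 1 0 / 10 ^+ 3) ^+ 2.
  rewrite -[leLHS]real_normK ?num_real// expr_div_n -(real_normK (num_real (w 1 0))) -expr_div_n.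
  by rewrite lerXn2r ?nnegrE ?divr_ge0 ?exprn_ge0.
(* The two squares bound the cross term of [w' 1 0 ^+ 2] from above and from below. *)
move: (sqr_ge0 (w 1 0 / 20 - 20 * (w' 1 0 - w 1 0))).
move: (sqr_ge0 (w 1 0 / 20 + 20 * (w' 1 0 - w 1 0))).
move: w0; move: (w 1 0) (w' 1 0); clear => y y' y0 k1 k2 k3.
by split; lra.
Qed.

(** Expansion along the middle column: the planar determinant is large by transversality, and the
    two other minors are the small components of a cross product. *)
Lemma frame_det l m S : cone l (col 0 S) -> mid_cone (col 1 S) ->
    cone m (col 2 S) -> m != l ->
  S 1 1 ^+ 2 * (r2 (col 0 S) * r2 (col 2 S)) <= 10 ^+ 5 * \det S ^+ 2.
Proof.
move=> ul [w0 wr] vm ml.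
have tr := cone_transverse _ _ _ _ ul vm ml.
have sm := cross_small _ _ _ _ ul vm.
have X0 : 0 < r2 (col 0 S) * r2 (col 2 S) by case: ul vm => u0 _ _ [v0 _ _]; rewrite mulr_gt0.
move: w0 wr tr sm; rewrite [r2 (cross _ _)]/r2 !crossE [r2 (col 1 S)]/r2 !mxE.
set X := r2 _ * r2 _ in X0 *; set P := _ * _ - _ * _.
set E1 := S 1 0 * _ - _; set E2 := S 0 0 * S 1 2 - _ => y0 wr tr sm.
have -> : \det S = S 1 1 * P - (S 0 1 * E1 + S 2 1 * E2).
  by rewrite det3 /P /E1 /E2; ring.
set s := S 0 1 * E1 + _.
have s2 : 10 ^+ 6 * s ^+ 2 <= S 1 1 ^+ 2 * X.
  have cs : s ^+ 2 <= (S 0 1 ^+ 2 + S 2 1 ^+ 2) * (E1 ^+ 2 + E2 ^+ 2).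
    have := cauchy_schwarz3 _ (S 0 1) (S 2 1) 0 E1 E2 0.
    by rewrite mul0r expr0n !addr0.
  have : (25 * (S 0 1 ^+ 2 + S 2 1 ^+ 2)) * (10 ^+ 6 * (E1 ^+ 2 + E2 ^+ 2)) <=
      S 1 1 ^+ 2 * (4 * X).
    by apply: ler_pM => //; rewrite ?mulr_ge0 ?addr_ge0 ?sqr_ge0 ?exprn_ge0 ?ler0n.
  move: cs (mulr_gt0 y0 X0); clear X0 tr sm wr y0.
  move: (s ^+ 2) (S 0 1 ^+ 2 + _) (E1 ^+ 2 + _) (S 1 1 ^+ 2) X; clear => a b c d x.
  lra.
have : S 1 1 ^+ 2 * X <= S 1 1 ^+ 2 * (10 ^+ 4 * P ^+ 2) by rewrite ler_pM2l.
(* Gives that [(S 1 1 * P - s) ^+ 2] is at least half of [(S 1 1 * P) ^+ 2] minus [s ^+ 2]. *)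
have := sqr_ge0 (S 1 1 * P - 2 * s); have := mulr_gt0 y0 X0.
move: s2; clear X0 tr sm y0.
by move: s (S 1 1) P X; clear => s y P X; lra.
Qed.

End Transversality.

Arguments cross {R} u v.

(** * Frames adapted to reduced words *)

Section Weights.
Variable R : realType.

(** At a vertex of a path, [l] is the letter that follows and [m] the one that precedes. *)
Definition adapted_frame (l m : letter) (M : 'M[R]_3) : Prop :=
  [/\ cone l (col 0 M), mid_cone (col 1 M) & cone (linv m) (col 2 M)].

Lemma telescope_ge (f : nat -> R) (a : R) k :
    (forall i, (i < k)%N -> a <= f i.+1 - f i) ->
  forall i j, (i <= j)%N -> (j <= k)%N -> (j - i)%:R * a <= f j - f i.
Proof.
move=> fa i j ij jk; rewrite -(subnK ij); have : (j - i + i <= k)%N by rewrite subnK.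
rewrite addnK; elim: (j - i)%N => [|n IH] nk; first by rewrite mul0r subrr.
rewrite -natr1 mulrDl mul1r addSn.
have := fa (n + i)%N nk; have := IH (ltnW nk); lra.
Qed.

Lemma telescope_le (f : nat -> R) (b : R) k :
    (forall i, (i < k)%N -> f i.+1 - f i <= b) ->
  forall i j, (i <= j)%N -> (j <= k)%N -> f j - f i <= (j - i)%:R * b.
Proof.
move=> fb i j ij jk.
have fb' n : (n < k)%N -> - b <= - f n.+1 - - f n by move=> /fb; lra.
have := telescope_ge (fun n => - f n) (- b) k fb' i j ij jk.
by rewrite mulrN; lra.
Qed.

Lemma simple_roots_ge3 (c : R) (H : 'rV[R]_3) :
  c <= H 0 0 - H 0 1 -> c <= H 0 1 - H 0 2 -> simple_roots_ge c H.
Proof.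
move=> h1 h2 i j ji.
have [[-> ->]//|[-> ->]//] : (i = 0 /\ j = 1) \/ (i = 1 /\ j = 2).
by move: i j ji; apply: ord3P; apply: ord3P => //= _; [left|right].
Qed.

Lemma simple_roots_ge_regular (c : R) (H : 'rV[R]_3) :
  0 < c -> simple_roots_ge c H -> regular_dominant H.
Proof. by move=> c0 Hc i j ji; apply: lt_le_trans c0 (Hc i j ji). Qed.

Lemma ln_ratio (a b x y : R) : 0 < a -> 0 < b -> 0 < y -> a * y <= x -> x <= b * y ->
  ln a <= ln x - ln y <= ln b.
Proof.
move=> a0 b0 y0 ax xb; have x0 : 0 < x by rewrite (lt_le_trans _ ax)// mulr_gt0.
rewrite lerBrDr lerBlDr -!lnM ?posrE//; apply/andP.
by split; rewrite ler_ln// posrE mulr_gt0.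
Qed.

(* At each step squared lengths in the cones grow by a factor at least 105/100,
   and those in the middle direction vary by a factor at most 102/100. *)
Definition root_gap : R := (ln (105 / 100) - ln (102 / 100)) / 2.

Definition step_size : R := ln 8.

(** Least gain of a simple root per step, divided by the largest gain of [cartan_norm], the factor 2
    being that of [cartan_norm_le]. *)
Definition regularity : R := root_gap / (2 * step_size).

Lemma root_gap_gt0 : 0 < root_gap.
Proof. by rewrite divr_gt0// subr_gt0 ltr_ln ?posrE; lra. Qed.

Lemma step_size_gt0 : 0 < step_size.
Proof. by rewrite ln_gt0// ltr1n. Qed.

Lemma regularity_gt0 : 0 < regularity.
Proof.
apply: divr_gt0; first exact: root_gap_gt0.
by apply: mulr_gt0 => //; exact: step_size_gt0.
Qed.

(** Squared sizes of the columns. For the middle one only the dominant entry is kept, this being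
    what [mid_step] controls. *)
Definition frame_sizes (M : 'M[R]_3) : 'rV[R]_3 :=
  \row_j nth 0 [:: r2 (col 0 M); M 1 1 ^+ 2; r2 (col 2 M)] j.

Definition mean_log (N : 'rV[R]_3) : R := (ln (N 0 0) + ln (N 0 1) + ln (N 0 2)) / 3.

(** Scaling column j by the exponential of the weight gives all columns the squared size
    [expR (mean_log N)]; the mean makes the trace vanish. *)
Definition log_weights (N : 'rV[R]_3) : 'rV[R]_3 :=
  \row_j ((mean_log N - ln (N 0 j)) / 2).

Lemma log_weights_cartan N : cartan (log_weights N).
Proof. rewrite /cartan /= sum3 !mxE /mean_log; lra. Qed.

(** After rescaling, the common squared size is the cube root of the product of the sizes, which
    [frame_det] bounds by 10^5 since the determinant is 1. The entries that [frame_sizes] ignores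
    cost at most a factor 2 per column. *)
Lemma adapted_frame_F2 l m M : l != linv m -> SL3 M -> adapted_frame l m M ->
  F2 (M *m cartan_exp (log_weights (frame_sizes M))) <= 6 * 10 ^+ 5.
Proof.
move=> lm M1 [c0 c1 c2].
have ml : linv m != l by rewrite eq_sym.
have := frame_det _ _ _ _ c0 c1 c2 ml; rewrite M1 expr1n mulr1.
have [N0 N0E] : exists x, x = r2 (col 0 M) by eexists.
have [N2 N2E] : exists x, x = r2 (col 2 M) by eexists.
have [N1 N1E] : exists x, x = M 1 1 ^+ 2 by eexists.
case: c0 c1 c2 => p0 _ p1 [w0 w1] [q0 _ q1].
rewrite -N0E -N2E -N1E => NN.
rewrite [r2 (col 1 M)]/r2 !mxE -?N0E -?N1E -?N2E in p0 p1 w0 w1 q0 q1.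
have sE : frame_sizes M = \row_j nth 0 [:: N0; N1; N2] j by rewrite /frame_sizes N0E N1E N2E.
set H := log_weights _; set mu := mean_log (frame_sizes M).
have Hexp j : 0 < frame_sizes M 0 j ->
    expR (H 0 j) ^+ 2 = expR mu / frame_sizes M 0 j.
  move=> N0j; rewrite -expRM_natl /H [log_weights _ _ _]mxE mulrC divfK// -/mu expRD expRN lnK//.
have mu_le : expR mu <= 10 ^+ 5.
  have P0 : 0 < N1 * (N0 * N2) by rewrite !mulr_gt0.
  rewrite -[leRHS]lnK ?posrE ?exprn_gt0// ler_expR.
  have l1 : ln (N1 * (N0 * N2)) <= ln (10 ^+ 5 : R) by rewrite ler_ln ?posrE ?exprn_gt0.
  have l2 : 0 <= ln (10 ^+ 5 : R) by rewrite ln_ge0// exprn_ege1// ler1n.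
  have l3 : ln (N1 * (N0 * N2)) = ln N1 + (ln N0 + ln N2).
    by rewrite !lnM ?posrE ?mulr_gt0.
  have -> : mu = (ln N0 + ln N1 + ln N2) / 3 by rewrite /mu /mean_log sE !mxE.
  move: l1 l2; rewrite l3; move: (ln (10 ^+ 5)) (ln N0) (ln N1) (ln N2).
  clear=> *; lra.
have h0 : expR (H 0 0) ^+ 2 * N0 = expR mu.
  by rewrite Hexp sE !mxE//= divfK ?gt_eqF.
have h1 : expR (H 0 1) ^+ 2 * N1 = expR mu.
  by rewrite Hexp sE !mxE//= divfK ?gt_eqF.
have h2 : expR (H 0 2) ^+ 2 * N2 = expR mu.
  by rewrite Hexp sE !mxE//= divfK ?gt_eqF.
clear Hexp; clearbody H.
have e0 := sqr_ge0 (expR (H 0 0)); have e1 := sqr_ge0 (expR (H 0 1)).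
have e2 := sqr_ge0 (expR (H 0 2)).
have k0 := ler_wpM2l e0 p1; have k1 := ler_wpM2l e1 w1; have k2 := ler_wpM2l e2 q1.
rewrite F2E; under eq_bigr do under eq_bigr do rewrite mul_mx_diag !mxE exprMn.
rewrite !sum3; move: k0 k1 k2; rewrite N0E N2E /r2 !mxE in h0 h2 *.
move: h0 h1 h2 (expR_ge0 mu) mu_le; rewrite N1E.
move: (expR (H 0 0) ^+ 2) (expR (H 0 1) ^+ 2) (expR (H 0 2) ^+ 2) (expR mu) e0 e1 e2.
move: (sqr_ge0 (M 1 0)) (sqr_ge0 (M 1 2)).
clear; move=> a b x y z u x0 y0 z0 h0 h1 h2 u0 u1 k0 k1 k2.
have := mulr_ge0 x0 a; have := mulr_ge0 z0 b.
move: h0 h1 h2 u0 u1 k0 k1 k2; clear; lra.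
Qed.

Lemma ln_ratio_sym (b x y : R) : 0 < b -> 0 < x -> 0 < y -> y <= b * x -> x <= b * y ->
  - ln b <= ln x - ln y <= ln b.
Proof.
move=> b0 x0 y0 yx xy; rewrite -lnV ?posrE//.
by apply: ln_ratio => //; rewrite ?invr_gt0 // ler_pdivrMl.
Qed.

(** Along a path the first size shrinks, the third grows and the middle one hardly moves. The means
    cancel in the roots, and the halves come from the sizes being squared. *)
Lemma weights_step (N N' : 'rV[R]_3) (D := log_weights N' - log_weights N) :
    (forall j, 0 < N 0 j) -> (forall j, 0 < N' 0 j) ->
    105 / 100 * N' 0 0 <= N 0 0 -> N 0 0 <= 8 * N' 0 0 ->
    N' 0 1 <= 102 / 100 * N 0 1 -> N 0 1 <= 102 / 100 * N' 0 1 ->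
    105 / 100 * N 0 2 <= N' 0 2 -> N' 0 2 <= 8 * N 0 2 ->
  [/\ root_gap <= D 0 0 - D 0 1, root_gap <= D 0 1 - D 0 2 &
      forall j, - step_size <= D 0 j <= step_size].
Proof.
move=> N0 N'0 h1 h2 h3 h4 h5 h6.
have p105 : 0 < 105 / 100 :> R by lra.
have p102 : 0 < 102 / 100 :> R by lra.
have p8 : 0 < 8 :> R by lra.
have /andP[] := ln_ratio _ _ _ _ p105 p8 (N'0 0) h1 h2.
have /andP[] := ln_ratio _ _ _ _ p105 p8 (N0 2) h5 h6.
have /andP[] := ln_ratio_sym _ _ _ p102 (N0 1) (N'0 1) h3 h4.
have l1 : 0 < ln (102 / 100 : R) by rewrite ln_gt0//; lra.
have l2 : ln (102 / 100 : R) < ln (105 / 100 : R) by rewrite ltr_ln ?posrE//; lra.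
have l3 : ln (105 / 100 : R) < ln 8 by rewrite ltr_ln ?posrE//; lra.
have DE j : D 0 j = ((mean_log N' - ln (N' 0 j)) - (mean_log N - ln (N 0 j))) / 2.
  by rewrite !mxE; lra.
rewrite /step_size /root_gap; move: l1 l2 l3.
move: (ln (102 / 100)) (ln (105 / 100)) (ln 8) => a b c l1 l2 l3 k1 k2 k3 k4 k5 k6.
have DE0 := DE 0; have DE1 := DE 1; have DE2 := DE 2.
move: l1 l2 l3 k1 k2 k3 k4 k5 k6 DE0 DE1 DE2; rewrite /mean_log.
move: (ln (N 0 0)) (ln (N 0 1)) (ln (N 0 2)) (ln (N' 0 0)) (ln (N' 0 1)) (ln (N' 0 2)).
move: D {DE} => D; clear.
move=> x y z x' y' z' l1 l2 l3 k1 k2 k3 k4 k5 k6 D0 D1 D2; split.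
- by rewrite D0 D1; lra.
- by rewrite D1 D2; lra.
- by apply: ord3P; rewrite ?D0 ?D1 ?D2; apply/andP; split; lra.
Qed.

(** Root gains add up, while the norm is at most linear in the number of steps, so the ratio does
    not depend on [i] and [j]. *)
Lemma path_regular (H : nat -> 'rV[R]_3) k :
    (forall i, (i < k)%N ->
       [/\ root_gap <= (H i.+1 - H i) 0 0 - (H i.+1 - H i) 0 1,
           root_gap <= (H i.+1 - H i) 0 1 - (H i.+1 - H i) 0 2 &
           forall j, - step_size <= (H i.+1 - H i) 0 j <= step_size]) ->
  forall i j, (i <= j)%N -> (j <= k)%N ->
    simple_roots_ge (regularity * cartan_norm (H j - H i)) (H j - H i) /\
    ((i < j)%N -> regular_dominant (H j - H i)).
Proof.
move=> HH i j ij jk.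
have root (a b : 'I_3) : (forall i, (i < k)%N -> root_gap <= (H i.+1 - H i) 0 a - (H i.+1 - H i) 0 b) ->
    (j - i)%:R * root_gap <= (H j - H i) 0 a - (H j - H i) 0 b.
  move=> h; have := telescope_ge (fun n => H n 0 a - H n 0 b) root_gap k.
  move=> /(_ _ i j ij jk); rewrite !mxE.
  rewrite (_ : H j 0 a - H j 0 b - (H i 0 a - H i 0 b) =
               H j 0 a - H i 0 a - (H j 0 b - H i 0 b)); last by ring.
  by apply=> n nk; have := h n nk; rewrite !mxE; lra.
have r01 := root 0 1 (fun i ik => let: And3 p _ _ := HH i ik in p).
have r12 := root 1 2 (fun i ik => let: And3 _ p _ := HH i ik in p).
have size a : `|(H j - H i) 0 a| <= (j - i)%:R * step_size.
  rewrite ler_norml -mulrN !mxE.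
  have := telescope_ge (fun n => H n 0 a) (- step_size) k.
  move=> /(_ _ i j ij jk) ->; last first.
    by move=> n nk; have [_ _ /(_ a)/andP[]] := HH n nk; rewrite !mxE.
  apply: (telescope_le (fun n => H n 0 a) step_size k) => // n nk.
  by have [_ _ /(_ a)/andP[]] := HH n nk; rewrite !mxE.
have c0 : 0 <= (j - i)%:R * step_size by rewrite mulr_ge0// ltW// step_size_gt0.
have nH := cartan_norm_le _ _ _ c0 size.
have le : regularity * cartan_norm (H j - H i) <= (j - i)%:R * root_gap.
  rewrite (le_trans (ler_wpM2l (ltW regularity_gt0) nH))// /regularity.
  move: step_size_gt0; move: ((j - i)%:R : R) step_size root_gap => n x y x0.
  suff -> : y / (2 * x) * (2 * (n * x)) = n * y by [].
  by field; rewrite gt_eqF.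
split; first by apply: simple_roots_ge3; [exact: le_trans r01|exact: le_trans r12].
move=> lij; apply: (@simple_roots_ge_regular ((j - i)%:R * root_gap)).
  by rewrite mulr_gt0 ?root_gap_gt0// ltr0n subn_gt0.
exact: simple_roots_ge3.
Qed.

End Weights.

Arguments adapted_frame {R} l m M.
Arguments frame_sizes {R} M.
Arguments mean_log {R} N.
Arguments log_weights {R} N.

(** * Propagation of cones along reduced sequences of letters *)

Section Frames.
Variables (R : realType) (e : R) (rho : letter -> 'M[R]_3).
Hypotheses (e_gt0 : 0 < e) (e_sqr : e ^+ 2 = 7).
Hypothesis rho_near : forall l, near_model e l (rho l).
Hypothesis rho_SL3 : forall l, SL3 (rho l).
Hypothesis rhoV : forall l, rho (linv l) = invmx (rho l).
Implicit Types (s : nat -> letter) (G H : 'M[R]_3).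

Definition reduced_seq s := forall i, s i.+1 != linv (s i).

(** The product runs over [s 1], ..., [s i]. The letter [s 0] lies before the path and supplies the
    preceding letter at the vertex 0. *)
Fixpoint prefix_prod s (i : nat) : 'M[R]_3 :=
  if i is j.+1 then prefix_prod s j *m rho (s j.+1) else 1%:M.

Lemma prefix_SL3 s i : SL3 (prefix_prod s i).
Proof. by elim: i => [|i IH]; [exact: SL3_1|apply: SL3M]. Qed.

Lemma prefix_unit s i : prefix_prod s i \in unitmx.
Proof. exact/SL3_unit/prefix_SL3. Qed.

Lemma rho_unit l : rho l \in unitmx.
Proof. exact/SL3_unit. Qed.

Lemma prefix_invS s i n (A : 'M[R]_(3, n)) : invmx (prefix_prod s i) *m A =
  rho (s i.+1) *m (invmx (prefix_prod s i.+1) *m A).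
Proof.
rewrite /= -[in LHS](mulKVmx (prefix_unit s i.+1) A) /= -!mulmxA.
by rewrite mulKmx ?prefix_unit.
Qed.

Lemma prefix_trmxS s i n (A : 'M[R]_(3, n)) :
  (prefix_prod s i.+1)^T *m A = (rho (s i.+1))^T *m ((prefix_prod s i)^T *m A).
Proof. by rewrite /= trmx_mul mulmxA. Qed.

(** A fixed vector seen from vertex i is the letter [s i.+1] applied to its view from vertex i + 1,
    so the induction descends from [k]. In the forward version the inverse letters act instead. *)
Lemma backward_cone s k u i : reduced_seq s -> cone (s k.+1) u -> (i <= k)%N ->
  cone (s i.+1) (invmx (prefix_prod s i) *m (prefix_prod s k *m u)).
Proof.
move=> red uk ik; rewrite -(subKn ik); elim: (k - i)%N (leq_subr i k) => [|j IH] jk.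
  by rewrite subn0 mulKmx ?prefix_unit.
rewrite prefix_invS; set n := (k - j.+1)%N in IH *.
have nE : n.+1 = (k - j)%N by rewrite /n; lia.
rewrite nE.
have c := IH (ltnW jk).
by have [] := cone_step _ _ _ _ _ _ e_gt0 e_sqr (rho_near (s (k - j)%N)) c (red _).
Qed.

Lemma forward_cone s u i : reduced_seq s -> cone (linv (s 0)) u ->
  cone (linv (s i)) (invmx (prefix_prod s i) *m u).
Proof.
move=> red u0; elim: i => [|i IH]; first by rewrite /= invmx1 mul1mx.
have -> : invmx (prefix_prod s i.+1) *m u =
    rho (linv (s i.+1)) *m (invmx (prefix_prod s i) *m u).
  by rewrite [in RHS]prefix_invS rhoV mulKmx ?rho_unit.
by have [] // := cone_step _ _ _ _ _ _ e_gt0 e_sqr (rho_near (linv (s i.+1))) IH;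
  rewrite linvK eq_sym red.
Qed.

(** Covectors move by transposes. The model matrices are symmetric, so the transposed letters are
    near the same models and respect the same cones. *)
Lemma forward_dual_cone s u i : reduced_seq s -> cone (s 0) u ->
  cone (s i) ((prefix_prod s i)^T *m u).
Proof.
move=> red u0; elim: i => [|i IH]; first by rewrite /= trmx1 mul1mx.
rewrite prefix_trmxS.
have [] // := cone_step _ _ _ _ _ _ e_gt0 e_sqr (near_tr _ _ _ _ (rho_near (s i.+1))) IH.
by apply: contra (red i) => /eqP ->; rewrite linvK.
Qed.

Lemma backward_dual_cone s k u i : reduced_seq s ->
    cone (linv (s k.+1)) ((prefix_prod s k)^T *m u) -> (i <= k)%N ->
  cone (linv (s i.+1)) ((prefix_prod s i)^T *m u).
Proof.
move=> red uk ik; rewrite -(subKn ik); elim: (k - i)%N (leq_subr i k) => [|j IH] jk.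
  by rewrite subn0.
set n := (k - j.+1)%N in IH *.
have nE : n.+1 = (k - j)%N by rewrite /n; lia.
have -> : (prefix_prod s n)^T *m u =
    (rho (linv (s n.+1)))^T *m ((prefix_prod s n.+1)^T *m u).
  by rewrite prefix_trmxS rhoV trmx_inv mulKmx ?unitmx_tr ?rho_unit.
rewrite nE; have c := IH (ltnW jk).
have [] // := cone_step _ _ _ _ _ _ e_gt0 e_sqr
  (near_tr _ _ _ _ (rho_near (linv (s (k - j)%N)))) c.
by rewrite (inj_eq (can_inj linvK)) red.
Qed.

Lemma frames s k : reduced_seq s -> exists G, SL3 G /\
  forall i, (i <= k)%N -> adapted_frame (s i.+1) (s i) (invmx (prefix_prod s i) *m G).
Proof.
move=> red.
have [u uc] := center R (s k.+1); have [v vc] := center R (linv (s 0)).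
have [f fc] := center R (s 0); have [g gc] := center R (linv (s k.+1)).
pose p := prefix_prod s k *m u.
(* Chosen so that this covector, seen from vertex [k], is [g]. *)
pose g0 := (invmx (prefix_prod s k))^T *m g.
have g0c : cone (linv (s k.+1)) ((prefix_prod s k)^T *m g0).
  by rewrite /g0 trmx_inv mulKVmx ?unitmx_tr ?prefix_unit.
pose w := cross f g0.
have inv_w i : invmx (prefix_prod s i) *m w =
    cross ((prefix_prod s i)^T *m f) ((prefix_prod s i)^T *m g0).
  apply: (can_inj (mulKmx (prefix_unit s i))).
  by rewrite mulKVmx ?prefix_unit// cross_adj (prefix_SL3 s i) scale1r.
pose A : 'M[R]_3 := \matrix_(i, j) nth 0 [:: p i 0; w i 0; v i 0] j.
have A0 : col 0 A = p by apply/colP => i; rewrite !mxE.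
have A1 : col 1 A = w by apply/colP => i; rewrite !mxE.
have A2 : col 2 A = v by apply/colP => i; rewrite !mxE.
have colM B j : col j (B *m A) = B *m col j A by rewrite !colE mulmxA.
have Ai i : (i <= k)%N -> adapted_frame (s i.+1) (s i) (invmx (prefix_prod s i) *m A).
  move=> ik; split; rewrite colM ?A0 ?A1 ?A2.
  - exact: backward_cone.
  - rewrite inv_w; apply: (cross_mid _ (s i) (linv (s i.+1))).
    + exact: forward_dual_cone.
    + exact: backward_dual_cone g0c ik.
    + by apply: contra (red i) => /eqP <-; rewrite linvK.
  - exact: forward_cone.
have d0 : \det A != 0.
  have [c0 c1 c2] := Ai 0%N (leq0n k); rewrite /= invmx1 mul1mx in c0 c1 c2.
  have m0 : linv (s 0) != s 1 by rewrite eq_sym red.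
  have := frame_det _ _ _ _ c0 c1 c2 m0.
  case: c0 c1 c2 => r0 _ _ [y0 _] [q0 _ _]; rewrite [col 1 A 1 0]mxE in y0.
  apply: contraTneq => ->; rewrite expr0n mulr0 -ltNge.
  by apply: mulr_gt0 => //; apply: mulr_gt0.
(* Rescaling one column normalizes the determinant; the cones are invariant under nonzero scalars,
   negative ones included. *)
pose D : 'M[R]_3 := diag_mx (\row_j nth 0 [:: (\det A)^-1; 1; 1] j).
have AD0 B : col 0 (B *m (A *m D)) = (\det A)^-1 *: col 0 (B *m A).
  rewrite mulmxA; apply/colP => i; rewrite !mxE (bigD1 0)//= big1 ?addr0.
    by rewrite !mxE /= mulr1n mulrC.
  by move=> j /negPf j0; rewrite !mxE j0 mulr0n mulr0.
have ADj B j : j != 0 -> col j (B *m (A *m D)) = col j (B *m A).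
  move=> j0; rewrite mulmxA; apply/colP => i; rewrite !mxE (bigD1 j)//= big1 ?addr0.
    rewrite !mxE eqxx mulr1n; case: j j0 => [[|[|[|]]]//= ? _]; by rewrite mulr1.
  by move=> j' /negPf j'j; rewrite !mxE j'j mulr0n mulr0.
exists (A *m D); split.
  rewrite /SL3 /= det_mulmx det_diag big_ord_recl !big_ord_recl big_ord0 !mxE /=.
  by rewrite !mulr1 divff.
move=> i /Ai[c0 c1 c2]; split; rewrite ?AD0 ?ADj//.
by apply: coneZ => //; rewrite invr_neq0.
Qed.



(** The points [coset (G *m cartan_exp (H i))] lie in a single flat, and the bound on [F2] keeps
    each of them close to the i-th vertex of the path. *)
Lemma flats s k : reduced_seq s -> exists G (H : nat -> 'rV[R]_3),
  [/\ SL3 G,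
      forall i, (i <= k)%N -> cartan (H i),
      forall i, (i <= k)%N ->
        F2 (invmx (prefix_prod s i) *m G *m cartan_exp (H i)) <= 6 * 10 ^+ 5 &
      forall i j, (i <= j)%N -> (j <= k)%N ->
        simple_roots_ge (regularity R * cartan_norm (H j - H i)) (H j - H i) /\
        ((i < j)%N -> regular_dominant (H j - H i))].
Proof.
move=> red; have [G [G1 Gk]] := frames s k red.
pose M i := invmx (prefix_prod s i) *m G.
pose H i := log_weights (frame_sizes (M i)).
have colM i j : (i < k)%N -> col j (M i) = rho (s i.+1) *m col j (M i.+1).
  by move=> ik; rewrite /M prefix_invS !colE !mulmxA.
have colM' i j : (i < k)%N -> col j (M i.+1) = rho (linv (s i.+1)) *m col j (M i).
  by move=> ik; rewrite rhoV (colM i j ik) mulKmx ?rho_unit.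
exists G, H; split => //.
- by move=> i ik; apply: log_weights_cartan.
- move=> i ik; apply: (adapted_frame_F2 _ (s i.+1) (s i)); [exact: red| |exact: Gk].
  by apply: SL3M => //; apply/SL3V/prefix_SL3.
apply: path_regular => i ik.
have [c0 c1 c2] := Gk i (ltnW ik); have [c0' c1' c2'] := Gk i.+1 ik.
rewrite -/(M i) -/(M i.+1) in c0 c1 c2 c0' c1' c2'.
have [_ s1 s2] := cone_step _ _ _ _ _ _ e_gt0 e_sqr (rho_near (s i.+1)) c0' (red i.+1).
have s3 : linv (s i) != linv (linv (s i.+1)).
  by rewrite (inj_eq (can_inj linvK)); apply: contra (red i) => /eqP ->; rewrite linvK.
have [_ s4 s5] := cone_step _ _ _ _ _ _ e_gt0 e_sqr (rho_near (linv (s i.+1))) c2 s3.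
have [s6 s7] := mid_step _ _ _ _ _ (rho_near (s i.+1)) c1'.
rewrite -(colM i 0 ik) in s1 s2; rewrite -(colM i 1 ik) in s6 s7.
rewrite -(colM' i 2 ik) in s4 s5.
case: c0 c1 c2 c0' c1' c2' => p0 _ _ [p1 _] [p2 _ _] [p0' _ _] [p1' _] [p2' _ _].
rewrite ![col 1 _ _ _]mxE in s6 s7 p1 p1'.
have pos n : 0 < r2 (col 0 (M n)) -> 0 < M n 1 1 ^+ 2 -> 0 < r2 (col 2 (M n)) ->
    forall j, 0 < frame_sizes (M n) 0 j.
  by move=> ? ? ?; apply: ord3P; rewrite mxE.
apply: weights_step; [exact: pos|exact: pos|..]; rewrite ![frame_sizes _ _ _]mxE /=.
- by clear -s1; lra.
- by clear -s2; lra.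
- by clear -s6 p1 p1'; lra.
- by clear -s7 p1 p1'; lra.
- by clear -s4; lra.
- by clear -s5; lra.
Qed.

End Frames.

(** * The free group *)

Definition reduced (w : seq letter) : bool := sorted (fun a b => b != linv a) w.

Definition word_inv (w : seq letter) : seq letter := map linv (rev w).

Fixpoint lcp (u v : seq letter) : nat :=
  match u, v with
  | a :: u', b :: v' => if a == b then (lcp u' v').+1 else 0%N
  | _, _ => 0%N
  end.

Lemma lcp_ultrametric u v w : (minn (lcp u v) (lcp v w) <= lcp u w)%N.
Proof.
elim: u v w => [|a u IH] [|b v] [|c w] //=; rewrite ?minn0 ?min0n//.
have [->|ab] := eqVneq a b; last by rewrite min0n.
have [_|bc] := eqVneq b c; last by rewrite minn0.
by rewrite minnSS ltnS IH.
Qed.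

Lemma lcp_sym u v : lcp u v = lcp v u.
Proof.
by elim: u v => [|a u IH] [|b v] //=; rewrite eq_sym; case: eqVneq => // _; rewrite IH.
Qed.

Lemma lcp_split u v : exists c a b, [/\ u = c ++ a, v = c ++ b, size c = lcp u v &
  forall x a' y b', a = x :: a' -> b = y :: b' -> x != y].
Proof.
elim: u v => [|a u IH] v; first by exists [::], [::], v.
case: v => [|b v]; first by exists [::], (a :: u), [::].
rewrite /=; have [->|ab] := eqVneq a b.
  have [c [a' [b' [-> -> <- h]]]] := IH v.
  by exists (b :: c), a', b'.
by exists [::], (a :: u), (b :: v); split => // ? ? ? ? [<- _] [<- _].
Qed.

(** [size u + size v - 2 * lcp u v] is the distance in the tree of words, and [lcp] is the Gromov
    product at its root; its ultrametric inequality gives the four-point condition with constant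
    0. *)
Lemma four_points u v w z :
  (size u + size v - 2 * lcp u v + (size z + size w - 2 * lcp z w) <=
   maxn (size u + size z - 2 * lcp u z + (size v + size w - 2 * lcp v w))
        (size u + size w - 2 * lcp u w + (size v + size z - 2 * lcp v z)))%N.
Proof.
(* Ensures that no natural subtraction is truncated. *)
have le x y : (lcp x y <= size x)%N /\ (lcp x y <= size y)%N.
  have [c [a [b [-> -> <- _]]]] := lcp_split x y.
  by rewrite !size_cat !leq_addr.
have min4 (a b c d f g : nat) : (minn c f <= a)%N -> (minn g d <= a)%N ->
    (minn c g <= b)%N -> (minn f d <= b)%N -> (minn (c + d) (g + f) <= a + b)%N.
  by clear; rewrite !geq_min; lia.
have := min4 (lcp u v) (lcp z w) (lcp u z) (lcp v w) (lcp v z) (lcp u w).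
have := lcp_ultrametric u z v; have := lcp_ultrametric u w v.
have := lcp_ultrametric z u w; have := lcp_ultrametric z v w.
rewrite !(lcp_sym z u) !(lcp_sym z v) !(lcp_sym w v) => h1 h2 h3 h4 /(_ h4 h3 h2 h1).
move: (le u v) (le z w) (le u z) (le v w) (le u w) (le v z).
move: (lcp u v) (lcp u z) (lcp u w) (lcp v z) (lcp v w) (lcp z w).
move: (size u) (size v) (size w) (size z); clear.
move=> e f g h i a b c d j [? ?] [? ?] [? ?] [? ?] [? ?] [? ?].
rewrite geq_min leq_max => /orP[?|?]; apply/orP; [left|right]; lia.
Qed.

Lemma reduced_cat_inv a b : reduced a -> reduced b ->
    (forall x a' y b', a = x :: a' -> b = y :: b' -> x != y) ->
  reduced (word_inv a ++ b).
Proof.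
rewrite /reduced /word_inv => ra rb h.
have rai : sorted (fun a b => b != linv a) (map linv (rev a)).
  rewrite sorted_map rev_sorted; apply: sub_sorted ra => x y /=.
  by apply: contra => /eqP/(can_inj linvK) ->; rewrite linvK.
case: a b ra rb h rai => [|x a] [|y b] //= _ rb h; rewrite ?cats0//.
rewrite rev_cons map_rcons cat_rcons sorted_cat_cons => -> /=.
by rewrite rb linvK eq_sym (h x a y b).
Qed.

(** * Ping-pong: freeness, word length and hyperbolicity *)

Section FreeGroup.
Variables (R : realType) (e : R) (rho : letter -> 'M[R]_3).
Hypotheses (e_gt0 : 0 < e) (e_sqr : e ^+ 2 = 7).
Hypothesis rho_near : forall l, near_model e l (rho l).
Hypothesis rho_SL3 : forall l, SL3 (rho l).
Hypothesis rhoV : forall l, rho (linv l) = invmx (rho l).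

Definition wprod (w : seq letter) : 'M[R]_3 := \prod_(l <- w) rho l.

Lemma wprod_nil : wprod [::] = 1%:M. Proof. exact: big_nil. Qed.

Lemma wprod_cons l w : wprod (l :: w) = rho l *m wprod w.
Proof. exact: big_cons. Qed.

Lemma wprod_cat u v : wprod (u ++ v) = wprod u *m wprod v.
Proof. exact: big_cat. Qed.

Lemma wprod_SL3 w : SL3 (wprod w).
Proof.
by elim: w => [|l w IH]; rewrite ?wprod_nil ?wprod_cons; [exact: SL3_1|exact: SL3M].
Qed.

Lemma wprod_unit w : wprod w \in unitmx.
Proof. exact/SL3_unit/wprod_SL3. Qed.

Lemma wprod_cancel l w : wprod [:: l, linv l & w] = wprod w.
Proof. by rewrite !wprod_cons rhoV mulKVmx// SL3_unit. Qed.

Lemma wprod_inv w : wprod (word_inv w) = invmx (wprod w).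
Proof.
elim: w => [|l w IH]; first by rewrite /word_inv /= wprod_nil invmx1.
rewrite /word_inv rev_cons map_rcons -cats1 wprod_cat -/(word_inv w) IH.
rewrite !wprod_cons wprod_nil mulmx1 rhoV.
apply: (can_inj (mulKmx (wprod_unit (l :: w)))).
rewrite -wprod_cons [RHS]mulmxV ?wprod_unit//.
by rewrite wprod_cons -mulmxA mulKVmx ?wprod_unit// mulmxV// SL3_unit.
Qed.

Lemma wprod_cone m w u : reduced (rcons w m) -> cone m u ->
  cone (head m w) (wprod w *m u) /\
  (105 / 100) ^+ size w * r2 u <= r2 (wprod w *m u).
Proof.
move=> + um; elim: w => [|l w IH] /= red; first by rewrite wprod_nil mul1mx mul1r.
have red' : reduced (rcons w m) by apply: path_sorted red.
have [c le] := IH red'.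
have hl : head m w != linv l by case: w red {IH red' c le} => [|a w] /= /andP[].
have [c' le' _] := cone_step _ _ _ _ _ _ e_gt0 e_sqr (rho_near l) c hl.
rewrite wprod_cons -mulmxA; split => //.
rewrite exprS -mulrA; by move: le le'; lra.
Qed.

Lemma wprod_growth w : reduced w -> exists2 u : 'cV[R]_3, 0 < r2 u /\ u 1 0 ^+ 2 <= r2 u &
  (105 / 100) ^+ size w * r2 u <= r2 (wprod w *m u).
Proof.
move=> red; pose m := last (true, true) w.
have [u um] := center R m.
have red' : reduced (rcons w m).
  rewrite /m; case/lastP: w red {m um} => [//|w l] red; rewrite last_rcons.
  by rewrite -cats1 cat_rcons /reduced sorted_cat_cons [sorted _ _]red /= linv_neq.
exists u; last by have [] := wprod_cone _ _ _ red' um.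
case: um => u0 _ uy; split => //.
by move: uy (sqr_ge0 (u 1 0)); lra.
Qed.

Lemma wprod_eq1 w : reduced w -> wprod w = 1%:M -> w = [::].
Proof.
move=> red w1; have [u [u0 _]] := wprod_growth w red; rewrite w1 mul1mx => le.
apply/eqP; rewrite -size_eq0; apply/eqP; case: (size w) le => // n.
have : 1 < (105 / 100 : R) ^+ n.+1 by rewrite exprn_egt1//; lra.
rewrite -(ltr_pM2r u0) mul1r => /lt_le_trans h /h.
by rewrite ltxx.
Qed.

Lemma reduced_catr u v : reduced (u ++ v) -> reduced v.
Proof. by elim: u => //= l u IH /path_sorted. Qed.

(** Once the common prefix is cancelled nothing else cancels. Both the injectivity of [wprod] and
    the tree formula for [word_dist] rest on this. *)
Lemma wprod_split u v : reduced u -> reduced v -> exists w,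
  [/\ reduced w, wprod w = invmx (wprod u) *m wprod v,
      size w = (size u + size v - 2 * lcp u v)%N & w = [::] -> u = v].
Proof.
move=> ru rv; have [c [a [b [uE vE <- h]]]] := lcp_split u v.
exists (word_inv a ++ b); split.
- by apply: reduced_cat_inv => //; [move: ru|move: rv]; rewrite ?uE ?vE => /reduced_catr.
- rewrite wprod_cat wprod_inv uE vE !wprod_cat.
  apply: (can_inj (mulKmx (wprod_unit (c ++ a)))).
  rewrite wprod_cat -[in LHS]mulmxA mulKVmx ?wprod_unit//.
  by rewrite mulKVmx// -wprod_cat wprod_unit.
- by rewrite uE vE !size_cat size_map size_rev; lia.
move/eqP; rewrite -size_eq0 size_cat size_map size_rev addn_eq0 !size_eq0.
by move=> /andP[/eqP a0 /eqP b0]; rewrite uE vE a0 b0.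
Qed.

Lemma wprod_inj u v : reduced u -> reduced v -> wprod u = wprod v -> u = v.
Proof.
move=> ru rv uv; have [w [rw wE _ h]] := wprod_split u v ru rv.
by apply/h/wprod_eq1 => //; rewrite wE uv mulVmx// wprod_unit.
Qed.

Lemma wprod_reduce w : exists v, [/\ reduced v, wprod v = wprod w & (size v <= size w)%N].
Proof.
elim: w => [|l w [v [rv vE vs]]]; first by exists [::].
case: v rv vE vs => [|m v] rv vE vs.
  by exists [:: l]; rewrite !wprod_cons vE.
have [ml|ml] := eqVneq m (linv l).
  exists v; split; first exact: path_sorted rv.
    by rewrite [RHS]wprod_cons -vE ml -[RHS]wprod_cons wprod_cancel.
  by apply: leq_trans (leqnSn _) _; apply: leq_trans vs _; exact: leqnSn.
exists [:: l, m & v]; split => //; last by rewrite wprod_cons vE -wprod_cons.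
by rewrite /reduced /= ml.
Qed.

Let S : set 'M[R]_3 := [set rho (true, true); rho (false, true)].

Lemma letter_spelled x : S x \/ S x^-1 <-> exists l, x = rho l.
Proof.
have inv l : (rho l)^-1 = rho (linv l) by rewrite rhoV.
split=> [[[->|->]|[xE|xE]]|[[[] []] ->]].
- by exists (true, true).
- by exists (false, true).
- by exists (linv (true, true)); rewrite -inv -xE invrK.
- by exists (linv (false, true)); rewrite -inv -xE invrK.
- by left; left.
- by right; left; rewrite inv.
- by left; right.
- by right; right; rewrite inv.
Qed.

Lemma spelledP x n : spelled S x n <-> exists2 w, x = wprod w & size w = n.
Proof.
split=> [[w [ws -> <-]]|[w -> <-]].
  elim: w ws => [|y w IH] ws; first by exists [::] => //; rewrite wprod_nil big_nil.
  have [v vE vs] := IH (fun s sw => ws s (@mem_behead _ (y :: w) s sw)).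
  have /letter_spelled[l yE] := ws y (mem_head y w).
  by exists (l :: v); [rewrite wprod_cons big_cons vE yE|rewrite /= vs].
exists (map rho w); split; last by rewrite size_map.
  by move=> _ /mapP[l _ ->]; apply/letter_spelled; exists l.
by rewrite big_map.
Qed.

Lemma word_length_reduced w : reduced w -> word_length S (wprod w) = size w.
Proof.
move=> rw; have min m : spelled S (wprod w) m -> (size w <= m)%N.
  move=> /spelledP[v wv <-]; have [v' [rv' v'E v's]] := wprod_reduce v.
  by rewrite (wprod_inj w v') // v'E.
have sw : spelled S (wprod w) (size w) by apply/spelledP; exists w.
apply: xget_unique; first by split.
move=> n [sn nmin]; apply/eqP; rewrite eqn_leq min// andbT.
exact: nmin.
Qed.

Lemma generated_subgroup : subgroup_SL3 (generated S).
Proof.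
(* SL3 is itself one of the subgroups intersected by [smallest], which places the intersection
   inside it. *)
have top : subgroup_SL3 (@SL3 R) /\ S `<=` @SL3 R.
  split; last by move=> _ [->|->]; exact: rho_SL3.
  by split => // [|x y x1 y1]; [exact: SL3_1|apply: SL3M => //; exact: SL3V].
split.
- by move=> x /(_ _ top).
- by move=> A [[_ A1 _] _].
- move=> x y xG yG A AA; have [[_ _ AM] _] := AA.
  by apply: AM; [exact: xG|exact: yG].
Qed.

Lemma generated_wprod x : generated S x -> exists2 w, reduced w & x = wprod w.
Proof.
suff H : generated S `<=` [set wprod w | w in setT].
  by move=> /H[w _ <-]; have [v [rv vE _]] := wprod_reduce w; exists v.
apply: smallest_sub; last first.
  move=> _ [->|->]; [exists [:: (true, true)]|exists [:: (false, true)]] => //;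
  by rewrite wprod_cons wprod_nil mulmx1.
split.
- by move=> _ [w _ <-]; exact: wprod_SL3.
- by exists [::] => //; exact: wprod_nil.
move=> _ _ [u _ <-] [v _ <-]; exists (u ++ word_inv v) => //.
by rewrite wprod_cat wprod_inv.
Qed.

Lemma generated_dist x y : generated S x -> generated S y ->
  exists w, [/\ reduced w, x^-1 * y = wprod w & size w = word_dist S x y].
Proof.
move=> /generated_wprod[u ru ->] /generated_wprod[v rv ->].
have [w [rw wE _ _]] := wprod_split u v ru rv; exists w; split => //.
rewrite /word_dist (_ : _ * _ = wprod w) ?wE//.
by rewrite -wE word_length_reduced.
Qed.

Lemma generating_finite : finite_generating_set (generated S) S.
Proof. by split => //; rewrite /S; exact: finite_set2. Qed.

Lemma free_word_hyperbolic : word_hyperbolic (generated S).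
Proof.
exists S; first exact: generating_finite.
exists 0%N => x y z w xG yG zG wG.
have red v : generated S v -> exists2 u, reduced u & v = wprod u by exact: generated_wprod.
have [a ra ->] := red x xG; have [b rb ->] := red y yG.
have [c rc ->] := red z zG; have [d rd ->] := red w wG.
have dE u v : reduced u -> reduced v ->
    word_dist S (wprod u) (wprod v) = (size u + size v - 2 * lcp u v)%N.
  move=> ru rv; have [p [rp pE ps _]] := wprod_split u v ru rv.
  by rewrite -ps -word_length_reduced// pE.
by rewrite !dE// addn0 four_points.
Qed.

End FreeGroup.

(** * Diamonds *)

Section Diamonds.
Variable R : realType.
Implicit Types (A B g G : 'M[R]_3) (U V W : 'rV[R]_3).

(** A witness for the pair (B, A) is read backwards through [- H]. Vanishing trace turns the upper
    bounds [ln c / 2] on the coordinates into the two-sided bound [ln c]. *)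
Lemma dist_le_sym A B (c : R) : SL3 A -> SL3 B -> 1 <= c ->
  F2 (invmx A *m B) <= c -> dist (coset B) (coset A) <= 2 * ln c.
Proof.
move=> A1 B1 c1 Fc; rewrite /dist; set E := [set r | _].
have lnc : 0 <= ln c by rewrite ln_ge0.
have c0 : 0 < c by apply: lt_le_trans c1.
have [->|/set0P[r Er]] := eqVneq E set0; first by rewrite inf0 mulr_ge0.
have lbE : has_lbound E.
  by exists 0 => _ [g [H [_ _ _ _ ->]]]; exact: cartan_norm_ge0.
apply: le_trans (ge_inf lbE Er) _; case: Er => g [H [_ Hc BE AE ->]].
have BE' : coset B = coset (g *m cartan_exp H *m cartan_exp (- H)).
  by rewrite -mulmxA cartan_expNK mulmx1.
have FE := dist_witness _ _ _ _ _ A1 B1 AE BE'; rewrite FE in Fc.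
have Hi i : 2 * (- H) 0 i <= ln c.
  rewrite -[leLHS]expRK ler_ln ?posrE ?expR_gt0//.
  by rewrite (le_trans _ Fc)// expRM_natl (bigD1 i)//= lerDl sumr_ge0.
apply: cartan_norm_le => // i.
move: Hc; rewrite /cartan /= sum3 => Hc.
have := (Hi 0, Hi 1, Hi 2) => -[[]]; rewrite !mxE => H0 H1 H2.
by rewrite ler_norml; move: i; apply: ord3P; apply/andP; split; lra.
Qed.

Lemma dist_refl_le0 g : SL3 g -> dist (coset g) (coset g) <= 0.
Proof.
move=> g1; have := dist_le_sym g g 3 g1 g1; set E := dist _ _.
move=> _; apply: ge_inf.
  by exists 0 => _ [g' [H [_ _ _ _ ->]]]; exact: cartan_norm_ge0.
exists g, 0; split => //.
- by rewrite /cartan /= big1// => i _; rewrite mxE.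
- by rewrite cartan_exp0 mulmx1.
- by rewrite /cartan_norm big1 ?sqrtr0// => i _; rewrite mxE expr0n.
Qed.

Lemma cartan_norm_eq0 V : cartan_norm V = 0 -> V = 0.
Proof.
move=> V0; have := cartan_norm2 _ V; rewrite V0 expr0n /= => /esym/eqP.
rewrite psumr_eq0 => [/allP h|i _]; last by rewrite sqr_ge0.
apply/rowP => i; rewrite mxE; apply/eqP; rewrite -sqrf_eq0.
by have /(_ (mem_index_enum i)) := h i.
Qed.

Lemma cartan_normZ (c : R) V : 0 <= c -> cartan_norm (c *: V) = c * cartan_norm V.
Proof.
move=> c0; rewrite /cartan_norm -[in RHS](ger0_norm c0) -sqrtr_sqr -sqrtrM ?sqr_ge0//.
by rewrite mulr_sumr; congr Num.sqrt; apply: eq_bigr => i _; rewrite mxE exprMn.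
Qed.

Lemma unit_factor (a : R) V : 0 < a -> a <= 1 / 2 -> cartan V ->
    simple_roots_ge (a * cartan_norm V) V ->
  exists U t, [/\ unit_direction U, simple_roots_ge a U, 0 <= t & V = t *: U].
Proof.
move=> a0 a2 Vc Va; have [V0|V0] := eqVneq (cartan_norm V) 0.
  (* The zero vector has no direction of its own, so the middle direction of the chamber is used;
     both its roots equal [s], and [a <= 1 / 2] keeps [a] below [s]. *)
  pose s := (Num.sqrt 2)^-1 : R.
  have s2 : s ^+ 2 = 1 / 2 by rewrite exprVn sqr_sqrtr// div1r.
  have s0 : 0 < s by rewrite invr_gt0 sqrtr_gt0.
  have as_ : a <= s.
    have : a * a <= 1 / 2 * (1 / 2) by apply: ler_pM => //; exact: ltW.
    have sq (x y : R) : 0 <= x -> 0 <= y -> x ^+ 2 <= y ^+ 2 -> x <= y.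
      by move=> x0 y0; rewrite ler_pXn2r ?nnegrE.
    by move=> aa; apply: sq (ltW a0) (ltW s0) _; rewrite s2 expr2; lra.
  exists (\row_i nth 0 [:: s; 0; - s] i), 0; split => //.
  - split; first by rewrite /cartan /= sum3 !mxE /=; lra.
    rewrite /cartan_norm sum3 !mxE /= sqrrN expr0n addr0 s2.
    by rewrite (_ : 1 / 2 + 1 / 2 = 1) ?sqrtr1//; lra.
  - by apply: simple_roots_ge3; rewrite !mxE /=; lra.
  - by rewrite scale0r; exact: cartan_norm_eq0.
have n0 : 0 < cartan_norm V by rewrite lt_neqAle eq_sym V0 cartan_norm_ge0.
exists ((cartan_norm V)^-1 *: V), (cartan_norm V); split.
- split; first exact: cartanZ.
  by rewrite cartan_normZ ?invr_ge0 ?ltW// mulVf.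
- move=> i j ij; have := Va i j ij; rewrite !mxE -mulrBr.
  by rewrite -(ler_pM2l (x := (cartan_norm V)^-1)) ?invr_gt0// mulrCA mulVf// mulr1.
- exact: ltW.
- by rewrite scalerA divff// scale1r.
Qed.

Lemma cone_point (a : R) g V W : 0 < a -> a <= 1 / 2 -> SL3 g ->
    cartan V -> cartan W -> regular_dominant W -> simple_roots_ge (a * cartan_norm V) V ->
  weyl_cone (coset g) (segment_chamber (coset g) (coset (g *m cartan_exp W))) a
    (coset (g *m cartan_exp V)).
Proof.
move=> a0 a2 g1 Vc Wc Wr Va.
have [U [t [U1 Ua t0 ->]]] := unit_factor a V a0 a2 Vc Va.
have Ud : dominant U by move=> i j ij; apply: le_trans (ltW a0) (Ua i j ij).
exists (std_ray g U), t; split => //.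
- exists g, W; split => //; split; first by exists g, U.
  exists U; split => //; exists 0 => s _; apply: dist_refl_le0.
  apply: SL3M => //; apply: det_cartan_exp; apply: cartanZ; by case: U1.
- by rewrite /std_ray scale0r cartan_exp0 mulmx1.
- by exists g, U.
Qed.

(** The longest element of the Weyl group; composed with negation it is the opposition involution,
    which preserves dominance. *)
Definition row_rev V : 'rV[R]_3 := \row_i nth 0 [:: V 0 2; V 0 1; V 0 0] i.

(* A representative in SO(3) of the longest element of the Weyl group. *)
Definition flip : 'M[R]_3 := mx3 [:: [:: 0; 0; 1]; [:: 0; -1; 0]; [:: 1; 0; 0]].

Lemma flip_SO3 : SO3 flip.
Proof.
split; last by rewrite det3 !mx3E; ring.
by apply: matrix3P; rewrite mulmx3E !id3E ![_^T _ _]mxE !mx3E; ring.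
Qed.

Lemma cartan_exp_flip V : cartan_exp V *m flip = flip *m cartan_exp (row_rev V).
Proof.
apply: matrix3P; rewrite !mulmx3E !mx3E /cartan_exp !mxE /= ?mulr1n ?mulr0n; ring.
Qed.

Lemma row_rev_cartan V : cartan V -> cartan (row_rev V).
Proof. by rewrite /cartan /= !sum3 !mxE /=; lra. Qed.

Lemma row_rev_norm V : cartan_norm (row_rev (- V)) = cartan_norm V.
Proof.
by rewrite /cartan_norm !sum3 !mxE /=; congr Num.sqrt; ring.
Qed.

Lemma row_rev_roots (c : R) V : simple_roots_ge c V -> simple_roots_ge c (row_rev (- V)).
Proof.
move=> Vc; have h1 := Vc 0 1 erefl; have h2 := Vc 1 2 erefl.
by apply: simple_roots_ge3; rewrite !mxE /=; lra.
Qed.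

Lemma regular_dominant3 V : V 0 1 < V 0 0 -> V 0 2 < V 0 1 -> regular_dominant V.
Proof.
move=> h1 h2 i j ji; rewrite subr_gt0.
have [[-> ->]//|[-> ->]//] : (i = 0 /\ j = 1) \/ (i = 1 /\ j = 2).
by move: i j ji; apply: ord3P; apply: ord3P => //= _; [left|right].
Qed.

Lemma row_rev_regular V : regular_dominant V -> regular_dominant (row_rev (- V)).
Proof.
move=> Vc; have h1 := Vc 0 1 erefl; have h2 := Vc 1 2 erefl.
by apply: regular_dominant3; rewrite !mxE /=; lra.
Qed.

(** Seen from the far end the displacements are antidominant. Multiplying the base frame there by
    [flip] leaves the point unchanged and makes them dominant again, so [cone_point] serves both
    ends. *)
Lemma diamond_flat (a : R) G (A B C : 'rV[R]_3) : 0 < a -> a <= 1 / 2 -> SL3 G ->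
    cartan A -> cartan B -> cartan C -> regular_dominant (B - A) ->
    simple_roots_ge (a * cartan_norm (C - A)) (C - A) ->
    simple_roots_ge (a * cartan_norm (B - C)) (B - C) ->
  diamond a (coset (G *m cartan_exp A)) (coset (G *m cartan_exp B))
    (coset (G *m cartan_exp C)).
Proof.
move=> a0 a2 G1 Ac Bc Cc BA CA BC.
have shift (X Y : 'rV[R]_3) : G *m cartan_exp Y = G *m cartan_exp X *m cartan_exp (Y - X).
  by rewrite -mulmxA -cartan_expD addrC subrK.
have rev (Y : 'rV[R]_3) : coset (G *m cartan_exp Y) =
    coset (G *m cartan_exp B *m flip *m cartan_exp (row_rev (- (B - Y)))).
  by rewrite opprB -[in RHS]mulmxA -cartan_exp_flip mulmxA (cosetM _ _ _ flip_SO3) -shift.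
have cB X Y : cartan X -> cartan Y -> cartan (X - Y).
  by move=> Xc Yc; apply: cartanD => //; exact: cartanN.
split.
  rewrite (shift A B) (shift A C); apply: cone_point => //; try exact: cB.
  by apply: SL3M => //; exact: det_cartan_exp.
rewrite -(cosetM _ (G *m cartan_exp B) _ flip_SO3) (rev A) (rev C).
apply: cone_point => //.
- by apply: SL3M; [apply: SL3M => //; exact: det_cartan_exp|apply: SO3_SL3; exact: flip_SO3].
- by apply/row_rev_cartan/cartanN; exact: cB.
- by apply/row_rev_cartan/cartanN; exact: cB.
- exact: row_rev_regular.
- by rewrite row_rev_norm; exact: row_rev_roots.
Qed.

Lemma regularity_le_half : regularity R <= 1 / 2.
Proof.
rewrite /regularity ler_pdivrMr ?mulr_gt0 ?step_size_gt0//.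
have l1 : 0 < ln (102 / 100 : R) by rewrite ln_gt0//; lra.
have l3 : ln (105 / 100 : R) < ln 8 by rewrite ltr_ln ?posrE//; lra.
have l4 : 0 < ln (8 : R) by rewrite ln_gt0//; lra.
by rewrite /root_gap /step_size; lra.
Qed.

End Diamonds.

Lemma SL3_invM (R : realType) (A B : 'M[R]_3) : SL3 A -> SL3 B ->
  invmx (A *m B) = invmx B *m invmx A.
Proof.
move=> A1 B1; have AB := SL3_unit _ _ (SL3M _ _ _ A1 B1).
apply: (can_inj (mulKmx AB)); rewrite mulmxV// -mulmxA mulKVmx ?SL3_unit//.
by rewrite mulmxV// SL3_unit.
Qed.

Lemma mulmx_sqr_le (R : realType) (A : 'M[R]_3) (u : 'cV[R]_3) :
  r2 (A *m u) <= F2 A * (r2 u + u 1 0 ^+ 2).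
Proof.
rewrite /r2 F2E !sum3 !mulmx3E.
have c i := cauchy_schwarz3 _ (A i 0) (A i 1) (A i 2) (u 0 0) (u 1 0) (u 2 0).
rewrite (_ : u 0 0 ^+ 2 + u 2 0 ^+ 2 + _ = u 0 0 ^+ 2 + u 1 0 ^+ 2 + u 2 0 ^+ 2); last by ring.
have n : 0 <= (A 1 0 ^+ 2 + A 1 1 ^+ 2 + A 1 2 ^+ 2) * (u 0 0 ^+ 2 + u 1 0 ^+ 2 + u 2 0 ^+ 2).
  by rewrite mulr_ge0// !addr_ge0// sqr_ge0.
rewrite !mulrDl; move: (c 0) (c 2) n; rewrite !mulrDl; lra.
Qed.

Lemma itv_convex (I : interval int) (x y z : int) :
  x \in I -> y \in I -> x <= z -> z <= y -> z \in I.
Proof.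
case: I => l r; rewrite !itv_boundlr => /andP[lx _] /andP[_ yr] xz zy.
apply/andP; split; first by rewrite (le_trans lx)// lteBSide.
by rewrite (le_trans _ yr)// lteBSide.
Qed.

(** * Orbit estimates and the Morse property *)

Section Orbit.
Variables (R : realType) (e : R) (rho : letter -> 'M[R]_3).
Hypotheses (e_gt0 : 0 < e) (e_sqr : e ^+ 2 = 7).
Hypothesis rho_near : forall l, near_model e l (rho l).
Hypothesis rho_SL3 : forall l, SL3 (rho l).
Hypothesis rhoV : forall l, rho (linv l) = invmx (rho l).

Let S : set 'M[R]_3 := [set rho (true, true); rho (false, true)].
Let gdist := generated_dist _ _ _ e_gt0 e_sqr rho_near rho_SL3 rhoV.
Let prefix := prefix_prod R rho.

Definition rho_bound : R := 1 + F2 (rho (true, true)) + F2 (rho (true, false)) +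
  F2 (rho (false, true)) + F2 (rho (false, false)).

Lemma rho_bound_ge1 : 1 <= rho_bound.
Proof. by rewrite /rho_bound -!addrA lerDl !addr_ge0 ?F2_ge0. Qed.

Lemma F2_rho l : F2 (rho l) <= rho_bound.
Proof.
have := F2_ge0 _ (rho (true, true)); have := F2_ge0 _ (rho (true, false)).
have := F2_ge0 _ (rho (false, true)); have := F2_ge0 _ (rho (false, false)).
by rewrite /rho_bound; case: l => [[] []]; lra.
Qed.

Lemma F2_wprod_le w : F2 (wprod R rho w) <= 3 * rho_bound ^+ size w.
Proof.
have C0 : 0 <= rho_bound by rewrite (le_trans _ rho_bound_ge1).
elim: w => [|l w IH].
  by rewrite wprod_nil F2E !sum3 !id3E expr0; lra.
rewrite wprod_cons (le_trans (F2M _ _ _))// exprS mulrCA.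
by apply: ler_pM; rewrite ?F2_ge0 ?F2_rho.
Qed.

Lemma F2_wprod_ge w : reduced w -> (105 / 100) ^+ size w <= 2 * F2 (wprod R rho w).
Proof.
move=> rw; have [u [u0 uy] le] := wprod_growth _ _ _ e_gt0 e_sqr rho_near w rw.
rewrite -(ler_pM2r u0) (le_trans le)// (le_trans (mulmx_sqr_le _ _ _))//.
rewrite [2 * _]mulrC -mulrA; apply: ler_wpM2l; [exact: F2_ge0|lra].
Qed.

(** Distortion of [F2] under conjugation by [P]; the summand 1 makes the logarithm nonnegative. *)
Definition basepoint_bound (P : 'M[R]_3) : R := 1 + F2 P * F2 (invmx P).

Lemma basepoint_bound_ge1 P : 1 <= basepoint_bound P.
Proof. by rewrite lerDl mulr_ge0 ?F2_ge0. Qed.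

Lemma F2_conj_le P Q B : F2 P * F2 Q <= basepoint_bound B - 1 ->
  forall M, F2 (P *m M *m Q) <= basepoint_bound B * F2 M.
Proof.
move=> PQ M; rewrite (le_trans (F2M _ _ _))//.
rewrite (le_trans (ler_wpM2r (F2_ge0 _ _) (F2M _ _ _)))// mulrAC.
apply: ler_wpM2r; first exact: F2_ge0.
by rewrite (le_trans PQ)// lerBlDr lerDl.
Qed.

Lemma orbit_dist P x y w : SL3 P -> SL3 x -> SL3 y -> reduced w ->
    x^-1 * y = wprod R rho w ->
  (ln (105 / 100) / 2) * (size w)%:R - ln (6 * basepoint_bound P) / 2 <=
    dist (coset (x *m P)) (coset (y *m P)) <=
  2 * ln rho_bound * (size w)%:R + 2 * ln (3 * basepoint_bound P).
Proof.
move=> P1 x1 y1 rw xy; set K := basepoint_bound P.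
have K1 : 1 <= K := basepoint_bound_ge1 P.
have K0 : 0 < K by apply: lt_le_trans K1.
have xP := SL3M _ _ _ x1 P1; have yP := SL3M _ _ _ y1 P1.
have E : invmx (x *m P) *m (y *m P) = invmx P *m wprod R rho w *m P.
  rewrite SL3_invM// -mulmxA [invmx x *m _]mulmxA.
  by rewrite (_ : invmx x *m y = wprod R rho w)// mulmxA.
have C1 := rho_bound_ge1.
have C0 : 0 < rho_bound by apply: lt_le_trans C1.
have q0 : 0 < 105 / 100 :> R by rewrite divr_gt0.
have k6 : 0 < 6 * K by rewrite mulr_gt0.
have k3 : 0 < 3 * K by rewrite mulr_gt0.
apply/andP; split.
  have c0 : 0 < (105 / 100) ^+ size w / (2 * K).
    by rewrite divr_gt0 ?exprn_gt0// mulr_gt0.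
  have le : (105 / 100) ^+ size w / (2 * K) <= F2 (invmx (x *m P) *m (y *m P)).
    rewrite E ler_pdivrMr ?mulr_gt0// (le_trans (F2_wprod_ge w rw))//.
    rewrite mulrCA ler_wpM2l// mulrC.
    (* Undoing the conjugation transfers the growth of the word to the relative position of the
       orbit points. *)
    rewrite [X in F2 X <= _](_ : _ = P *m (invmx P *m wprod R rho w *m P) *m invmx P).
      by apply: F2_conj_le; rewrite /basepoint_bound addrC addKr.
    by rewrite !mulmxA mulmxV ?SL3_unit// mul1mx -mulmxA mulmxV ?SL3_unit// mulmx1.
  apply: le_trans (dist_ge _ _ _ _ xP yP c0 le).
  rewrite [X in _ <= ln X / 2](_ : _ = (105 / 100) ^+ size w * (6 * K)^-1); last first.
    by rewrite -mulrA -invfM; congr (_ / _); ring.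
  have -> : ln ((105 / 100) ^+ size w * (6 * K)^-1) =
      ln (105 / 100) * (size w)%:R - ln (6 * K).
    by rewrite [LHS]lnM ?posrE ?exprn_gt0 ?invr_gt0// lnV ?posrE// lnXn// mulr_natr.
  by rewrite mulrBl mulrAC.
have c1 : 1 <= 3 * K * rho_bound ^+ size w.
  have z1 : 1 <= rho_bound ^+ size w by rewrite exprn_ege1.
  have z2 : 1 <= 3 * K by lra.
  by rewrite -[leLHS]mulr1; apply: ler_pM.
have le : F2 (invmx (x *m P) *m (y *m P)) <= 3 * K * rho_bound ^+ size w.
  rewrite E (le_trans (F2_conj_le (invmx P) P P _ _))//.
    by rewrite /basepoint_bound mulrC [X in _ <= X]addrC addKr.
  by rewrite [3 * K]mulrC -mulrA ler_wpM2l ?F2_wprod_le// ltW.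
apply: le_trans (dist_le _ _ _ _ xP yP c1 le) _.
have -> : ln (3 * K * rho_bound ^+ size w) = ln (3 * K) + ln rho_bound * (size w)%:R.
  by rewrite [LHS]lnM ?posrE ?exprn_gt0// lnXn// mulr_natr.
by rewrite mulrDr addrC mulrA.
Qed.

Lemma generated_SL3 x : generated S x -> SL3 x.
Proof. by have [h _ _] := generated_subgroup _ _ rho_SL3; apply: h. Qed.

Lemma geodesic_letters (gam : int -> 'M[R]_3) (n m : int) :
    n <= m -> (forall x, n <= x <= m -> generated S (gam x)) ->
    (forall x y, n <= x <= m -> n <= y <= m -> word_dist S (gam x) (gam y) = `|y - x|%N) ->
  exists2 s, reduced_seq s & forall i, (i <= `|m - n|)%N ->
    gam (n + i%:Z) = gam n *m prefix s i.
Proof.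
move=> nm gG gd; set k := `|m - n|%N.
have inI i : (i <= k)%N -> n <= n + i%:Z <= m by rewrite /k; lia.
have letters i : exists l, (i < k)%N -> gam (n + i.+1%:Z) = gam (n + i%:Z) *m rho l.
  have [ik|] := ltnP i k; last by exists (true, true).
  have iG := gG _ (inI _ (ltnW ik)).
  have [w [_ wE ws]] := gdist _ _ iG (gG _ (inI _ ik)).
  rewrite gd ?inI// in ws; last exact: ltnW.
  have {}ws : size w = 1%N by rewrite ws; lia.
  case: w wE ws => [|l [|]]//= wE _; exists l => _.
  rewrite wprod_cons wprod_nil mulmx1 in wE.
  rewrite -wE [(_ * _)%R](_ : _ = invmx (gam (n + i%:Z)) *m gam (n + i.+1%:Z))//.
  by rewrite mulKVmx// SL3_unit//; exact: generated_SL3.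
have [f fE] := choice letters.
(* The letter from vertex i to vertex i + 1 becomes [s i.+1]. Clamping repeats the first letter at 0
   and the last one beyond [k]; a repeated letter keeps the sequence reduced, and elsewhere a
   backtrack would contradict geodesicity. *)
pose s i := f (minn i.-1 k.-1); exists s.
  move=> i; rewrite /s /=; have [->|ne] := eqVneq (minn i k.-1) (minn i.-1 k.-1).
    exact: linv_neq.
  have [i0 ik] : (0 < i)%N /\ (i < k)%N by lia.
  have -> : minn i k.-1 = i by lia.
  have -> : minn i.-1 k.-1 = i.-1 by lia.
  apply/eqP => fi.
  have back : gam (n + i.+1%:Z) = gam (n + i.-1%:Z).
    have := fE i.-1; rewrite (prednK i0) fE// => ->; last by lia.
    by rewrite fi -mulmxA rhoV mulmxV ?SL3_unit// mulmx1.
  have := gd (n + i.-1%:Z) (n + i.+1%:Z); rewrite back gd ?inI; lia.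
elim=> [|i IH] ik; first by rewrite addr0 /= mulmx1.
rewrite /= -/prefix mulmxA -IH ?(ltnW ik)// fE//.
by rewrite /s /= (_ : minn i k.-1 = i)//; lia.
Qed.

(** A bound on [F2]; the distance is twice its logarithm. The factor [rho_bound] pays for comparing
    the last vertex with the flat point one step further. *)
Definition morse_distance (P : 'M[R]_3) : R :=
  2 + rho_bound * (F2 (invmx P) * (6 * 10 ^+ 5)).

Lemma morse_distance_ge P :
  [/\ 1 < morse_distance P, F2 (invmx P) * (6 * 10 ^+ 5) <= morse_distance P &
      F2 (invmx P) * (rho_bound * (6 * 10 ^+ 5)) <= morse_distance P].
Proof.
rewrite /morse_distance [_ * (rho_bound * _)]mulrCA.
have := rho_bound_ge1; have : 0 <= F2 (invmx P) * (6 * 10 ^+ 5).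
  by rewrite mulr_ge0 ?F2_ge0// mulr_ge0// exprn_ge0.
move: (_ * (6 * _)) rho_bound => x y x0 y1.
have : x <= y * x by rewrite ler_peMl.
by move=> xy; split; lra.
Qed.

Lemma geodesic_diamond P (gam : int -> 'M[R]_3) (n m : int) : SL3 P ->
    n <= m -> (forall x, n <= x <= m -> generated S (gam x)) ->
    (forall x y, n <= x <= m -> n <= y <= m -> word_dist S (gam x) (gam y) = `|y - x|%N) ->
  exists a b, [/\ symspace a, symspace b,
    dist a (coset (gam n *m P)) <= 2 * ln (morse_distance P),
    dist b (coset (gam m *m P)) <= 2 * ln (morse_distance P) &
    forall i : int, n <= i <= m -> exists2 z, diamond (regularity R) a b z &
      dist (coset (gam i *m P)) z <= 2 * ln (morse_distance P)].
Proof.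
move=> P1 nm gG gd; have [s red sE] := geodesic_letters gam n m nm gG gd.
set k := `|m - n|%N in sE.
(* The flat is taken one step beyond the last vertex, so that the segment from [a] to [b] is regular
   even when [n = m]. *)
have [G [H [G1 Hc HF Hr]]] :=
  flats _ _ _ e_gt0 e_sqr rho_near rho_SL3 rhoV s k.+1 red.
have [D1 DP DrP] := morse_distance_ge P.
have nI : n <= n <= m by rewrite lexx.
have mI : n <= m <= m by rewrite nm lexx.
have g1 x : n <= x <= m -> SL3 (gam x) by move=> /gG; exact: generated_SL3.
have gP x : n <= x <= m -> SL3 (gam x *m P) by move=> xI; apply: SL3M => //; exact: g1.
have F1 : SL3 (gam n *m G) by apply: SL3M => //; exact: g1.
pose z i := gam n *m G *m cartan_exp (H i).
have z1 i : (i <= k.+1)%N -> SL3 (z i).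
  by move=> ik; apply: SL3M => //; apply: det_cartan_exp; exact: Hc.
have pr i := prefix_unit _ _ rho_SL3 s i.
have rel i (ik : (i <= k)%N) j : invmx (gam (n + i%:Z) *m P) *m z j =
    invmx P *m (invmx (prefix s i) *m G *m cartan_exp (H j)).
  have p1 := prefix_SL3 _ _ rho_SL3 s i; have gn1 := g1 n nI.
  rewrite sE// (SL3_invM _ _ _ (SL3M _ _ _ gn1 p1) P1) (SL3_invM _ _ _ gn1 p1).
  by rewrite /z -!mulmxA mulKmx// SL3_unit.
have close i : (i <= k)%N -> F2 (invmx (gam (n + i%:Z) *m P) *m z i) <= morse_distance P.
  move=> ik; rewrite rel// (le_trans (F2M _ _ _))// (le_trans _ DP)//.
  by apply: ler_wpM2l; [exact: F2_ge0|apply: HF; exact: leqW].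
have mE : m = n + k%:Z by rewrite /k; lia.
exists (coset (z 0%N)), (coset (z k.+1)); split.
- by exists (z 0%N) => //; exact: z1.
- by exists (z k.+1) => //; exact: z1.
- apply: dist_le_sym; [exact: gP|exact: z1|exact: ltW|].
  by have := close 0%N (leq0n _); rewrite addr0.
- apply: dist_le_sym; [exact: gP|exact: z1|exact: ltW|].
  rewrite {1}mE rel// (le_trans (F2M _ _ _))// (le_trans _ DrP)//.
  apply: ler_wpM2l; first exact: F2_ge0.
  have -> : invmx (prefix s k) *m G = rho (s k.+1) *m (invmx (prefix s k.+1) *m G).
    by rewrite -prefix_invS.
  rewrite -mulmxA (le_trans (F2M _ _ _))//.
  by apply: ler_pM; [exact: F2_ge0|exact: F2_ge0|exact: F2_rho|exact: HF].
move=> i iI; pose j := `|i - n|%N.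
have jk : (j <= k)%N by rewrite /j /k; lia.
have iE : i = n + j%:Z by rewrite /j; lia.
exists (coset (z j)).
  have [h1 _] := Hr 0%N j (leq0n _) (leqW jk).
  have [h2 _] := Hr j k.+1 (leqW jk) (leqnn _).
  have [_ h3] := Hr 0%N k.+1 (leq0n _) (leqnn _).
  apply: diamond_flat => //; try exact: Hc.
  - exact: regularity_gt0.
  - exact: regularity_le_half.
  - by apply: Hc; exact: leqW.
  - exact: h3.
apply: dist_le; [exact: gP|apply: z1; exact: leqW|exact: ltW|].
by rewrite {1}iE; exact: close.
Qed.

Theorem near_model_anosov : anosov (generated S).
Proof.
split.
- exact: generated_subgroup.
- exact: free_word_hyperbolic e_gt0 e_sqr rho_near rho_SL3 rhoV.
exists S; first exact: generating_finite.
move=> p [P P1 <-]; have K1 := basepoint_bound_ge1 P; set K := basepoint_bound P in K1.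
have C1 := rho_bound_ge1.
have lq : 0 < ln (105 / 100 : R) by rewrite ln_gt0//; lra.
have [D1 _ _] := morse_distance_ge P.
exists (ln (105 / 100) / 2)^-1, (ln (6 * K) / 2), (2 * ln rho_bound + 1),
  (2 * ln (3 * K)), (2 * ln (morse_distance P)), (regularity R).
split; last split.
- split; first by rewrite invr_gt0 divr_gt0.
    by rewrite divr_gt0// ln_gt0; lra.
  by rewrite ltr_wpDl// mulr_ge0// ln_ge0.
- split; [|by rewrite mulr_gt0// ln_gt0|exact: regularity_gt0].
  by rewrite mulr_gt0// ln_gt0; lra.
move=> I gam [gG gd].
have g1 n : n \in I -> SL3 (gam n) by move=> /gG; exact: generated_SL3.
split.
- by move=> n nI; rewrite actE; exists (gam n *m P) => //; apply: SL3M => //; exact: g1.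
- move=> n N nI nNI; rewrite invrK !actE.
  have [w [rw wE ws]] := gdist _ _ (gG _ nI) (gG _ nNI).
  rewrite gd// (_ : n + N - n = N) in ws; last by ring.
  have -> : `|N|%:~R = (size w)%:R :> R by rewrite ws natr_absz.
  have /andP[lo hi] := orbit_dist P _ _ w P1 (g1 _ nI) (g1 _ nNI) rw wE.
  rewrite lo (le_trans hi)// lerD2r ler_wpM2r// lerDl ler01//.
move=> n m nI mI nm.
have conv x : n <= x <= m -> x \in I by move=> /andP[]; exact: itv_convex.
have [a [b [a1 b1 da db ab]]] := geodesic_diamond P gam n m P1 nm
  (fun x xI => gG x (conv x xI)) (fun x y xI yI => gd x y (conv x xI) (conv y yI)).
exists a, b; split => //; rewrite ?actE// => i /ab[z za zd].
by exists z => //; rewrite actE.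
Qed.

End Orbit.

(** * The perturbed generators *)

Section Closeness.
Variable R : realType.
Implicit Types (A B : 'M[R]_3) (e : R).

(** The adjugate, equal to the inverse on SL3; being polynomial in the entries, it is easy to
    perturb. *)
Definition adj3 A : 'M[R]_3 := mx3
  [:: [:: A 1 1 * A 2 2 - A 1 2 * A 2 1; A 0 2 * A 2 1 - A 0 1 * A 2 2;
          A 0 1 * A 1 2 - A 0 2 * A 1 1];
      [:: A 1 2 * A 2 0 - A 1 0 * A 2 2; A 0 0 * A 2 2 - A 0 2 * A 2 0;
          A 0 2 * A 1 0 - A 0 0 * A 1 2];
      [:: A 1 0 * A 2 1 - A 1 1 * A 2 0; A 0 1 * A 2 0 - A 0 0 * A 2 1;
          A 0 0 * A 1 1 - A 0 1 * A 1 0]].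

Lemma invmx_adj3 A : SL3 A -> invmx A = adj3 A.
Proof.
move=> A1; apply: (can_inj (mulKmx (SL3_unit _ _ A1))); rewrite mulmxV ?SL3_unit//.
by apply: matrix3P; rewrite mulmx3E !id3E !mx3E -?A1 ?det3; ring.
Qed.

(** A product of two entries moves by at most (1 + 3 + 3) d, and each cofactor is a difference of
    two products. *)
Lemma adj3_near (d : R) A B : 0 <= d -> d <= 1 -> (forall i j, `|B i j| <= 3) ->
    (forall i j, `|A i j - B i j| <= d) ->
  forall i j, `|adj3 A i j - adj3 B i j| <= 14 * d.
Proof.
move=> d0 d1 hB hAB.
have hp i j k l : `|A i j * A k l - B i j * B k l| <= 7 * d.
  rewrite (_ : _ - _ = (A i j - B i j) * (A k l - B k l) +
    (A i j - B i j) * B k l + B i j * (A k l - B k l)); last by ring.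
  have h1 : `|(A i j - B i j) * (A k l - B k l)| <= d * 1.
    by rewrite normrM ler_pM// (le_trans (hAB k l)).
  have h2 : `|(A i j - B i j) * B k l| <= d * 3 by rewrite normrM ler_pM.
  have h3 : `|B i j * (A k l - B k l)| <= 3 * d by rewrite normrM ler_pM.
  rewrite (le_trans (ler_normD _ _))//.
  by move: h1 h2 h3 (ler_normD ((A i j - B i j) * (A k l - B k l)) ((A i j - B i j) * B k l)); lra.
have hs i j k l i' j' k' l' :
    `|A i j * A k l - A i' j' * A k' l' - (B i j * B k l - B i' j' * B k' l')| <= 14 * d.
  rewrite (_ : _ - _ = (A i j * A k l - B i j * B k l) -
    (A i' j' * A k' l' - B i' j' * B k' l')); last by ring.
  by move: (hp i j k l) (hp i' j' k' l') (ler_normB (A i j * A k l - B i j * B k l)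
    (A i' j' * A k' l' - B i' j' * B k' l')); lra.
by apply: ord3P; apply: ord3P; rewrite !mx3E; exact: hs.
Qed.

Lemma adj3_model e l : e ^+ 2 = 7 -> adj3 (model e l) = model e (linv l).
Proof.
by move=> e2; case: l => [[] []]; apply: matrix3P; rewrite !mx3E; field: e2.
Qed.

Lemma model_le3 e l : 0 < e -> e ^+ 2 = 7 -> forall i j, `|model e l i j| <= 3.
Proof.
move=> e0 e2; have e3 : e <= 3 by nra.
by case: l => [[] []]; apply: ord3P; apply: ord3P; rewrite !mx3E ler_norml; apply/andP;
  split; lra.
Qed.

Lemma frobenius_coord A i j : `|A i j| <= frobenius A.
Proof.
rewrite -sqrtr_sqr /frobenius ler_wsqrtr// -[leRHS]/(F2 A) F2E (bigD1 i)//= (bigD1 j)//=.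
rewrite -addrA lerDl addr_ge0//; first by apply: sumr_ge0 => k _; exact: sqr_ge0.
by apply: sumr_ge0 => k _; apply: sumr_ge0 => k' _; exact: sqr_ge0.
Qed.

Lemma near_model_frobenius e l A : 0 < e -> e ^+ 2 = 7 -> SL3 A ->
    frobenius (model e l - A) <= 10 ^- 9 ->
  near_model e l A /\ near_model e (linv l) (invmx A).
Proof.
move=> e0 e2 A1 close.
have h i j : `|A i j - model e l i j| <= 10 ^- 9.
  by rewrite distrC (le_trans _ close)//; have := frobenius_coord (model e l - A) i j; rewrite !mxE.
have d0 : 0 <= 10 ^- 9 :> R by rewrite invr_ge0 exprn_ge0.
have d1 : 10 ^- 9 <= 1 :> R by rewrite invf_le1 ?exprn_gt0// exprn_ege1// ler1n.
have d6 : 14 * 10 ^- 9 <= 10 ^- 6 :> R by lra.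
split=> i j; first by rewrite (le_trans (h i j))//; lra.
rewrite invmx_adj3// -adj3_model// (le_trans _ d6)//.
exact: adj3_near (model_le3 e l e0 e2) h i j.
Qed.

Lemma exp_sqr_of_tanh (t : R) : tanh t = 3 / 4 ->
  expR t ^+ 2 = 7 /\ expR (- t) = expR t / 7.
Proof.
rewrite /tanh /sinh /cosh => th.
have p := expR_gt0 t; have q := expR_gt0 (- t).
have pq : expR t * expR (- t) = 1 by rewrite -expRD subrr expR0.
have E : expR t = 7 * expR (- t).
  have c0 : (expR t + expR (- t)) / 2 != 0 by rewrite gt_eqF// divr_gt0// addr_gt0.
  have : (expR t - expR (- t)) / 2 = 3 / 4 * ((expR t + expR (- t)) / 2).
    by rewrite -th divfK.
  by lra.
split; last by move: E; lra.
by rewrite expr2 {1}E -mulrA [expR (- t) * _]mulrC pq mulr1.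
Qed.

End Closeness.

Theorem theorem1p2 (R : realType) (t : R) (g h : 'M[R]_3)
    (t_gt0 : 0 < t) (tanh_t : tanh t = 3 / 4)
    (g_def : g = mx3 [:: [:: expR t; 0; 0];
                         [:: 0; 1; 0];
                         [:: 0; 0; expR (- t)]])
    (h_def : h = mx3 [:: [:: cosh t; 0; sinh t];
                         [:: 0; 1; 0];
                         [:: sinh t; 0; cosh t]])
    (g' h' : 'M[R]_3) (g'_SL3 : SL3 g') (h'_SL3 : SL3 h')
    (close : Num.max (frobenius (g - g')) (frobenius (h - h')) <= 10 ^- 15309) :
  anosov (generated [set g'; h']).
Proof.
have [e2 eN] := exp_sqr_of_tanh _ t tanh_t.
have e0 := expR_gt0 t; set e := expR t in e2 eN e0 *.
have gE : g = model e (true, true) by rewrite g_def eN.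
have hE : h = model e (false, true).
  have c1 : (e + e / 7) / 2 = 4 * e / 7 by clear; lra.
  have c2 : (e - e / 7) / 2 = 3 * e / 7 by clear; lra.
  by rewrite h_def /cosh /sinh -/e eN c1 c2.
have small : 10 ^- 15309 <= 10 ^- 9 :> R.
  rewrite lef_pV2 ?posrE ?exprn_gt0//; apply: ler_weXn2l; first by rewrite ler1n.
  by [].
move: close; rewrite ge_max => /andP[gc hc].
have [g1 g2] : near_model e (true, true) g' /\ near_model e (true, false) (invmx g').
  by apply: near_model_frobenius => //; rewrite -gE (le_trans gc).
have [h1 h2] : near_model e (false, true) h' /\ near_model e (false, false) (invmx h').
  by apply: near_model_frobenius => //; rewrite -hE (le_trans hc).
pose rho (l : letter) := let x := if l.1 then g' else h' in if l.2 then x else invmx x.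
apply: (near_model_anosov R e rho e0 e2).
- by case=> [[] []].
- by case=> [[] []]; rewrite /rho /=; try exact: SL3V.
- by case=> [[] []]; rewrite /rho /= ?invmxK.
Qed.
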